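(* Let $\mathcal{H}=\mathcal{H}(X)$ be a reproducing kernel Hilbert space, let $A,B\in\mathscr{B}(\mathcal{H})$, and let $(f_1,g_1)$ and $(f_2,g_2)$ be pairs of mutually complementary Orlicz functions. Then for any $\alpha,\beta,\lambda\in[0,1]$, $$ \begin{aligned} \mathrm{ber}^2(A+B)\le 2\Big(&\big(\mathrm{ber}^2(A)+\mathrm{ber}^2(B)\big)\ \nabla_\lambda\\ &\sqrt2\,\mathrm{ber}\Big(f_1(|A|^{2\alpha})+f_2(|B|^{2\beta})+i\big(g_1(|A^*|^{2(1-\alpha)})+g_2(|B^*|^{2(1-\beta)})\big)\Big)\Big), \end{aligned} $$ where $a\nabla_\lambda b=(1-\lambda)a+\lambda b$.
   Context: Reproducing kernel Hilbert space: $X$ is a non-empty set and $\mathcal{H}=\mathcal{H}(X)$ is a Hilbert space of complex-valued functions on $X$ such that for every $x\in X$ the evaluation $\phi\mapsto\phi(x)$ is continuous on $\mathcal{H}$. For $x\in X$, $k_x\in\mathcal{H}$ is the unique element with $\phi(x)=\langle\phi,k_x\rangle$ for all $\phi\in\mathcal{H}$, and $\hat k_x=k_x/\|k_x\|$ is the normalized reproducing kernel (so it is implicit that $k_x\neq 0$ for all $x\in X$). $\mathscr{B}(\mathcal{H})$ is the algebra of bounded linear operators on $\mathcal{H}$, and $|T|=(T^*T)^{1/2}$; powers of positive operators are defined by functional calculus, with $|T|^0=I$. For $T\in\mathscr{B}(\mathcal{H})$, the Berezin number is $\mathrm{ber}(T)=\sup_{x\in X}|\langle T\hat k_x,\hat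 k_x\rangle|$, and $\mathrm{ber}^2(T)=(\mathrm{ber}(T))^2$. Orlicz function: a continuous, convex, non-decreasing $f:[0,\infty)\to[0,\infty)$ with $f(0)=0$ and $f(u)\to\infty$ as $u\to\infty$; throughout, Orlicz functions are assumed non-degenerate, i.e. $f(u)>0$ for all $u>0$. Such an $f$ is represented as $f(u)=\int_0^u p(t)\,dt$, where the kernel $p$ is non-decreasing with $p(0)=0$, $p(t)>0$ for $t>0$ and $\lim_{t\to\infty}p(t)=\infty$. Let $q(s)=\sup\{t: p(t)\le s\}$, $s\ge0$, be the right inverse of $p$ ($q$ has properties similar to those of $p$). The complementary Orlicz function to $f$ is $g(v)=\int_0^v q(s)\,ds$, and $(f,g)$ is called a pair of mutually complementary Orlicz functions. For a positive operator $T$, $f(T)$ is defined by the continuous functional calculus. *)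

(* Defs.v *)
From HB Require Import structures.
From mathcomp Require Import all_boot all_order all_algebra.
From mathcomp Require Import sesquilinear complex.
From mathcomp Require Import all_classical all_reals all_analysis.

Set Implicit Arguments.
Unset Strict Implicit.
Unset Printing Implicit Defensive.

Import Order.TTheory GRing.Theory Num.Theory numFieldNormedType.Exports.

Local Open Scope classical_set_scope.
Local Open Scope ring_scope.
Local Open Scope complex_scope.

(* A Hilbert space of functions on X is encoded as a complete normed space whose
   norm comes from an inner product (linear in its first argument), together
   with an injective linear map [rkhs_fun] sending each vector to the function
   on X that it is; the operations on functions are the pointwise ones. *)
Record rkhs (R : realType) (X : Type) := Rkhs {
  rkhs_space :> completeNormedModType R[i] ;
  rkhs_dot : {dot rkhs_space for (@Num.conj R[i])} ;
  rkhs_normE : forall u : rkhs_space, `|u| ^+ 2 = rkhs_dot u u ;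
  rkhs_fun : {linear rkhs_space -> (X -> R[i]^o)} ;
  rkhs_fun_inj : injective rkhs_fun ;
  rkhs_eval_continuous : forall x : X,
    continuous (fun phi : rkhs_space => rkhs_fun phi x : R[i]^o)
}.

Section Operators.
Context {R : realType}.

Section Normed.
Context {H : normedModType R[i]}.
Implicit Types T S : H -> H.

Definition spectrum T : set R[i] :=
  [set z | ~ exists S, [/\ linear S, continuous S,
                           cancel (fun u => T u - z *: u) S &
                           cancel S (fun u => T u - z *: u)]].

Definition poly_op (p : {poly R}) T : H -> H :=
  fun u => \sum_(i < size p) (p`_i)%:C *: iter i T u.

(* Continuous functional calculus for a self-adjoint T: [S] is the limit in
   operator norm of p(T) as the polynomials p approximate f uniformly on the
   spectrum of T, which consists of real numbers. *)
Definition is_cfc (f : R -> R) T S :=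
  forall e : R, 0 < e -> exists p : {poly R},
    (forall t : R, spectrum T t%:C -> `|p.[t] - f t| <= e) /\
    (forall u : H, `|poly_op p T u - S u| <= e%:C * `|u|).

Definition cfc (f : R -> R) T : H -> H := xget 0 [set S | is_cfc f T S].

End Normed.

Section Inner.
Context {H : normedModType R[i]} (dot : {dot H for (@Num.conj R[i])}).
Implicit Types T : H -> H.

Definition adjoint T : H -> H :=
  xget 0 [set S | forall u v, dot (T u) v = dot u (S v)].

Definition abs_op T : H -> H := cfc Num.sqrt (adjoint T \o T).

(* |T| ^ r; since [0 `^ 0 = 1], the case r = 0 is the identity. *)
Definition abs_pow T (r : R) : H -> H := cfc (fun t => t `^ r) (abs_op T).

End Inner.
End Operators.

Section Berezin.
Context {R : realType} {X : Type} (H : rkhs R X).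

Definition rkernel (x : X) : H :=
  xget 0 [set k | forall phi : H, rkhs_fun H phi x = rkhs_dot H phi k].

Definition nrkernel (x : X) : H := `|rkernel x|^-1 *: rkernel x.

Definition ber (T : H -> H) : R :=
  sup [set complex.Re `|rkhs_dot H (T (nrkernel x)) (nrkernel x)|
      | x in [set: X]].

End Berezin.

Arguments ber {R X} H T.

Section Orlicz.
Context {R : realType}.
Implicit Types f g p : R -> R.

(* Functions on [0, +oo) are given by total functions R -> R whose values at
   negative arguments are irrelevant. *)
Definition orlicz f :=
  [/\ {within `[0, +oo[, continuous f},
      convex_function (`[0, +oo[ : set R) f,
      {in `[0, +oo[ &, {homo f : u v / u <= v}},
      f 0 = 0 &
      (forall u : R, 0 < u -> 0 < f u) /\ (f u @[u --> +oo] --> +oo)].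

Definition orlicz_kernel p :=
  [/\ {in `[0, +oo[ &, {homo p : s t / s <= t}},
      p 0 = 0,
      (forall t : R, 0 < t -> 0 < p t) &
      p t @[t --> +oo] --> +oo].

Definition right_inv p : R -> R :=
  fun s => sup [set t | 0 <= t /\ p t <= s].

Definition complementary f g :=
  orlicz f /\
  exists p, [/\ orlicz_kernel p,
    (forall u : R, 0 <= u -> f u = \int[lebesgue_measure]_(t in `[0, u]) p t) &
    (forall v : R, 0 <= v ->
       g v = \int[lebesgue_measure]_(s in `[0, v]) right_inv p s)].

End Orlicz.

(* a ∇_l b *)
Definition wmean {R : realType} (l a b : R) : R := (1 - l) * a + l * b.

(* Main.v *)
(* Fix a unit vector [k]. The mixed Schwarz inequality bounds [|<Ak, k>|^2] by
   [<|A|^(2 al) k, k> * <|A^*|^(2 (1 - al)) k, k>], and Young's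
   inequality [s t <= f s + g t], applied on the spectra, bounds this product by
   [<f(|A|^(2 al)) k, k> + <g(|A^*|^(2 (1 - al))) k, k>]. Adding the same bound for
   [B] and using [x + y <= sqrt 2 * |x + i y|] for real [x] and [y] gives
   [|<Ak, k>|^2 + |<Bk, k>|^2 <= sqrt 2 * ber(...)], while the left-hand side is
   trivially at most [ber^2 A + ber^2 B]; hence it is at most any weighted mean.

   Everything about the functional calculus rests on one fact: if a real polynomial
   [r] is nonnegative on the real spectrum of a self-adjoint [T], then [r(T) >= 0].
   If the best constant [m] with [m <= r(T)] were negative, [r - m] would have no
   zero on the spectrum, so [r(T) - m], a product of invertible factors [T - z],
   would be a positive invertible operator, hence bounded below by a positive
   constant, contradicting the choice of [m]. *)
Require Import Defs.
From HB Require Import structures.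
From mathcomp Require Import all_boot all_order all_algebra.
From mathcomp Require Import sesquilinear complex ring lra.
From mathcomp Require Import all_classical all_reals all_analysis measurable_realfun.

Set Implicit Arguments.
Unset Strict Implicit.
Unset Printing Implicit Defensive.

Import Order.TTheory GRing.Theory Num.Theory numFieldNormedType.Exports.

Local Open Scope classical_set_scope.
Local Open Scope ring_scope.
Local Open Scope complex_scope.

(** * Weierstrass approximation *)

(** The adjoint and f(T) are chosen by [xget] among the operators with the defining property, so
    each of them needs an existence proof: the adjoint comes from minimising a quadratic energy,
    f(T) from uniform approximation on an interval that contains the spectrum. No polar
    decomposition is available for the mixed Schwarz inequality. With T = A^* A and T' = A A^* , it
    is obtained from polynomials a, b with a b close to 1, together with the intertwining A p(T) =
    p(T') A. The obstacle is that b should resemble t ^ (- al / 2), which is singular at 0, a point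
    that the spectrum may contain; t is therefore shifted by a small e, and all errors are
    controlled by explicit constants. Most estimates concern real parts of inner products; a complex
    modulus is recovered at the end by multiplying a vector by a suitable scalar. The outer factor 2
    of the theorem is that of (a + b)^2 <= 2 (a^2 + b^2). *)

Section Weierstrass.
Context {R : realType}.
Implicit Types (f : R -> R) (phi : nat -> R).

(* De Casteljau's recursion for the Bernstein polynomial
   [\sum_(k <= n) phi k * 'C(n, k) * X^k * (1 - X)^(n - k)]. *)
Fixpoint bernstein n phi : {poly R} :=
  if n is m.+1 then
    'X * bernstein m (phi \o succn) + (1 - 'X) * bernstein m phi
  else (phi 0%N)%:P.

Lemma bernsteinS n phi (x : R) :
  (bernstein n.+1 phi).[x] =
  x * (bernstein n (phi \o succn)).[x] + (1 - x) * (bernstein n phi).[x].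
Proof. by rewrite /= !hornerE. Qed.

Lemma le_bernstein n phi psi (x : R) : 0 <= x <= 1 ->
  (forall k, (k <= n)%N -> phi k <= psi k) ->
  (bernstein n phi).[x] <= (bernstein n psi).[x].
Proof.
move=> x01; elim: n phi psi => [|n IH] phi psi le_pp.
  by rewrite /= !hornerC le_pp.
rewrite !bernsteinS lerD// ler_wpM2l ?IH//; try lra.
- by move=> k kn; apply: le_pp.
- by move=> k kn; apply: le_pp; apply: leqW.
Qed.

Lemma bernstein_affine n phi a b (x : R) :
  (bernstein n (fun k => a + b * phi k)).[x] = a + b * (bernstein n phi).[x].
Proof.
elim: n phi => [|n IH] phi; first by rewrite /= !hornerC.
by rewrite !bernsteinS !IH; ring.
Qed.

(** Second moment about [c] of a binomial law: variance plus squared bias. The centre [c] is free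
    because the shift by [succn] in the recursion turns it into [c - 1]. *)
Lemma bernstein_sqr n (c x : R) :
  (bernstein n (fun k => (k%:R - c) ^+ 2)).[x] =
  n%:R * x * (1 - x) + (n%:R * x - c) ^+ 2.
Proof.
elim: n c => [|n IH] c; first by rewrite /= hornerC; ring.
rewrite bernsteinS.
have -> : (fun k : nat => (k%:R - c) ^+ 2 : R) \o succn =
          fun k : nat => (k%:R - (c - 1)) ^+ 2.
  by apply/funext => k /=; rewrite -natr1; ring.
by rewrite !IH -natr1; ring.
Qed.

Lemma within_continuous_modulus f (M e : R) :
  {within `[0, M], continuous f} -> 0 < e ->
  exists2 d : R, 0 < d & forall x y, 0 <= x <= M -> 0 <= y <= M ->
    `|x - y| < d -> `|f x - f y| <= e.
Proof.
move=> /subspace_continuousP cf e0.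
pose P (d x : R) := forall y, 0 <= x <= M -> 0 <= y <= M ->
    `|x - y| < d -> `|f x - f y| <= e.
have e20 : 0 < e / 2 by rewrite divr_gt0.
have := (compact_near_coveringP _).1 (@segment_compact R 0 M).
move=> /(_ R (0 : R)^'+ P _) H.
have : \forall d \near (0 : R)^'+, `[0, M] `<=` P d.
  apply: H => x x0M.
  have := cf x x0M => /cvgrPdist_le/(_ _ e20).
  rewrite near_withinE => /nbhs_ballP[d /= d0 hd].
  have d20 : 0 < d / 2 by rewrite divr_gt0.
  near=> x' d' => /= y x'M yM xy.
  have d'd : d' < d / 2 by near: d'; apply: nbhs_right_lt.
  have xx' : `|x - x'| < d / 2.
    near: x'.
    exact: (@nbhsx_ballx _ R x _ d20).
  have h1 : `|f x - f x'| <= e / 2.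
    apply: hd; rewrite /ball/=; last by rewrite in_itv/=.
    by rewrite (lt_le_trans xx')//; lra.
  have h2 : `|f x - f y| <= e / 2.
    apply: hd; rewrite /ball/=; last by rewrite in_itv/=.
    have -> : x - y = (x - x') + (x' - y) by ring.
    rewrite (le_lt_trans (ler_normD _ _))//; lra.
  have -> : f x' - f y = - (f x - f x') + (f x - f y) by ring.
  by rewrite (le_trans (ler_normD _ _))// normrN; lra.
move=> Hn.
have [d [dd d0]] : exists d : R, `[0, M] `<=` P d /\ 0 < d.
  near (0 : R)^'+ => d; exists d; split; first by near: d.
  by near: d; exact: nbhs_right_gt.
exists d => // x y xM yM xy.
by apply: (dd x) => //=; rewrite in_itv.
Unshelve. all: by end_near.
Qed.

(** A quadratic bound is wanted because the Bernstein polynomials of quadratics are explicit. Close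
    points use uniform continuity; at distance at least [d], the factor (x - y)^2 / d^2 is at least
    1 and multiplies the full oscillation of [f]. *)
Lemma within_continuous_quadratic_modulus f (M e : R) :
  {within `[0, M], continuous f} -> 0 < e ->
  exists2 C : R, 0 <= C & forall x y, 0 <= x <= M -> 0 <= y <= M ->
    `|f x - f y| <= e + C * (x - y) ^+ 2.
Proof.
move=> cf e0; have [M0|M0] := ltP M 0.
  exists 0 => // x y xM; lra.
have [d d0 hd] := within_continuous_modulus cf e0.
have [x1 x1M f1] : exists2 c, c \in `[0, M]%R & forall t, t \in `[0, M]%R -> f t <= f c.
  exact: EVT_max.
have [x2 x2M f2] : exists2 c, c \in `[0, M]%R & forall t, t \in `[0, M]%R -> f c <= f t.
  exact: EVT_min.
have K0 : 0 <= f x1 - f x2 by rewrite subr_ge0 f2.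
exists ((f x1 - f x2) / d ^+ 2); first by rewrite divr_ge0// sqr_ge0.
move=> x y xM yM; have [xy|xy] := ltP `|x - y| d.
  rewrite (le_trans (hd _ _ xM yM xy))// lerDl.
  by rewrite mulr_ge0 ?sqr_ge0// divr_ge0// sqr_ge0.
have : `|f x - f y| <= f x1 - f x2.
  have := f1 x; have := f1 y; have := f2 x; have := f2 y.
  rewrite !in_itv/= => /(_ yM) ? /(_ xM) ? /(_ yM) ? /(_ xM) ?.
  by rewrite ler_norml; lra.
move=> /le_trans; apply.
apply: (@le_trans _ _ ((f x1 - f x2) / d ^+ 2 * (x - y) ^+ 2)); last by lra.
rewrite -mulrA ler_peMr// ler_pdivlMl ?exprn_gt0// mulr1.
by rewrite -[leRHS]real_normK ?num_real// lerXn2r// ?nnegrE ?(ltW d0).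
Qed.

Lemma weierstrass01 f (e : R) : {within `[0, 1], continuous f} -> 0 < e ->
  exists p : {poly R}, forall x, 0 <= x <= 1 -> `|p.[x] - f x| <= e.
Proof.
move=> cf e0; have e20 : 0 < e / 2 by rewrite divr_gt0.
have [C C0 hC] := within_continuous_quadratic_modulus cf e20.
pose n := (Num.truncn (C / (e / 2))).+1.
have nC : C / (e / 2) < n%:R by rewrite truncnS_gt.
have n0 : 0 < n%:R :> R by rewrite ltr0n.
exists (bernstein n (fun k => f (k%:R / n%:R))) => x x01.
(* With [x] fixed, [psi 1] and [psi (-1)] are an upper and a lower quadratic envelope of the samples
   of [f]; monotonicity of [bernstein] carries the enclosure over to the polynomials. *)
pose psi s k := f x + s * (e / 2 + C / n%:R ^+ 2 * (k%:R - n%:R * x) ^+ 2).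
have psiE s : (bernstein n (psi s)).[x] = f x + s * (e / 2 + C * x * (1 - x) / n%:R).
  rewrite /psi bernstein_affine bernstein_affine bernstein_sqr.
  by congr (_ + _ * (_ + _)); field; rewrite gt_eqF.
have small : e / 2 + C * x * (1 - x) / n%:R <= e.
  have : C * x * (1 - x) / n%:R <= e / 2; last lra.
  rewrite ler_pdivrMr//; move: nC; rewrite ltr_pdivrMr// => nC.
  have : C * (x * (1 - x)) <= C by rewrite ler_piMr//; nra.
  lra.
have bnd k : (k <= n)%N ->
   `|f (k%:R / n%:R) - f x| <= e / 2 + C / n%:R ^+ 2 * (k%:R - n%:R * x) ^+ 2.
  move=> kn; apply: le_trans (hC _ _ _ x01) _.
    by rewrite divr_ge0//= ler_pdivrMr// mul1r ler_nat.
  by rewrite le_eqVlt; apply/orP; left; apply/eqP; field; rewrite gt_eqF.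
have up : (bernstein n (fun k => f (k%:R / n%:R))).[x] <= (bernstein n (psi 1)).[x].
  apply: le_bernstein => // k kn; rewrite /psi mul1r.
  by have := bnd k kn; rewrite ler_norml; lra.
have lo : (bernstein n (psi (-1))).[x] <= (bernstein n (fun k => f (k%:R / n%:R))).[x].
  apply: le_bernstein => // k kn; rewrite /psi mulN1r.
  by have := bnd k kn; rewrite ler_norml; lra.
by move: up lo; rewrite !psiE ler_norml; lra.
Qed.

Lemma weierstrass f (M e : R) : 0 < M -> {within `[0, M], continuous f} -> 0 < e ->
  exists p : {poly R}, forall x, 0 <= x <= M -> `|p.[x] - f x| <= e.
Proof.
move=> M0 cf e0.
have cf1 : {within `[0, 1], continuous (fun x => f (M * x))}.
  apply/subspace_continuousP => x; rewrite /= in_itv/= => x01.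
  apply/cvgrPdist_le => e1 e10.
  have [d d0 hd] := within_continuous_modulus cf e10.
  have dM : 0 < d / M by rewrite divr_gt0.
  rewrite near_withinE; near=> y => /=; rewrite in_itv/= => y01.
  have xy : `|x - y| < d / M.
    near: y.
    exact: (@nbhsx_ballx _ R x _ dM).
  apply: hd; [nra|nra|].
  by rewrite -mulrBr normrM (gtr0_norm M0) mulrC -ltr_pdivlMr.
have [p hp] := weierstrass01 cf1 e0.
exists (p \Po (M^-1 *: 'X)) => x xM.
have xE : M * (x / M) = x by rewrite mulrC divfK ?gt_eqF.
have x1 : 0 <= x / M <= 1.
  by rewrite divr_ge0 ?(ltW M0)//= ?ler_pdivrMr// ?mul1r; lra.
by have := hp _ x1; rewrite horner_comp hornerZ hornerX (mulrC M^-1) xE.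
Unshelve. all: by end_near.
Qed.

End Weierstrass.

(** * Young's inequality *)

Section NondecreasingIntegral.
Context {R : realType} (p : R -> R).
Hypothesis p_homo : {in `[0, +oo[ &, {homo p : s t / s <= t}}.
Notation mu := (@lebesgue_measure R).
Let F u := \int[mu]_(t in `[0, u]) p t.

Lemma nondecreasing_integrable (b : R) : mu.-integrable `[0, b] (EFin \o p).
Proof.
have [b0|b0] := ltP b 0.
  by rewrite set_itv_ge ?bnd_simp -?ltNge//; exact: integrable_set0.
apply: measurable_bounded_integrable => //.
- by rewrite /= lebesgue_measure_itv/=; case: ifP; rewrite ?ltry// -EFinB ltry.
(* [p] is monotone on [0, +oo[ only; precomposition with [Num.max 0] gives a function monotone on
   the whole line that agrees with [p] on the interval. *)
- apply: (@eq_measurable_fun _ _ _ _ _ (fun t : R => p (Num.max 0 t)) p).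
    by move=> t; rewrite inE/= in_itv/= => /andP[t0 _]; rewrite max_r.
  apply: nondecreasing_measurable => // s t st.
  apply: p_homo; rewrite ?in_itv/= ?andbT.
  - by rewrite le_max lexx.
  - by rewrite le_max lexx.
  - by rewrite ge_max !le_max lexx/= st orbT.
- exists (`|p 0| + `|p b|); split; first exact: num_real.
  move=> M hM t /=; rewrite in_itv/= => /andP[t0 tb].
  apply: le_trans (ltW hM).
  have h1 : p 0 <= p t by apply: p_homo; rewrite ?in_itv/= ?lexx ?andbT.
  have h2 : p t <= p b by apply: p_homo; rewrite ?in_itv/= ?andbT.
  have := ler_norm (p b); have := ler_norm (- p 0); rewrite normrN.
  have := normr_ge0 (p 0); have := normr_ge0 (p b).
  by rewrite ler_norml; lra.
Qed.

Let F_sub a b : 0 <= a -> a <= b -> F b - F a = \int[mu]_(t in `]a, b[) p t.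
Proof.
move=> a0 ab; rewrite /F Rintegral_itvB//; last exact: nondecreasing_integrable.
rewrite Rintegral_itv_bndo_bndc//.
apply: integrableS (nondecreasing_integrable b) => //.
by move=> t /=; rewrite !in_itv/= => /andP[/ltW/(le_trans a0)-> /ltW].
Qed.

Let mu_oo (a b : R) : a <= b -> fine (mu `]a, b[) = b - a.
Proof.
move=> ab; rewrite lebesgue_measure_itv/= lte_fin.
by case: ltP => //= ba; rewrite (@le_anti _ _ a b) ?subrr ?ab.
Qed.

Let int_oo a b : 0 <= a -> mu.-integrable `]a, b[ (EFin \o p).
Proof.
move=> a0; apply: integrableS (nondecreasing_integrable b) => //.
by move=> t /=; rewrite !in_itv/= => /andP[/ltW/(le_trans a0)-> /ltW].
Qed.

Let int_cst (m a b : R) : mu.-integrable `]a, b[ (EFin \o cst m).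
Proof.
apply: measurable_bounded_integrable => //.
  by rewrite /= lebesgue_measure_itv/=; case: ifP; rewrite ?ltry// -EFinB ltry.
exists `|m|; split; first exact: num_real.
by move=> M /ltW hM t _ /=.
Qed.

(** The bound is asked on the open interval only: a right inverse controls [p] strictly to the left
    and strictly to the right of its value, not at the value itself. *)
Lemma Rintegral_increment_ge (m a b : R) : 0 <= a -> a <= b ->
  (forall t, a < t < b -> m <= p t) -> m * (b - a) <= F b - F a.
Proof.
move=> a0 ab mp; rewrite F_sub// -(mu_oo ab) -Rintegral_cst//.
apply: le_Rintegral; [by []|exact: int_cst|exact: int_oo|].
by move=> t /=; rewrite in_itv/=; exact: mp.
Qed.

Lemma Rintegral_increment_le (m a b : R) : 0 <= a -> a <= b ->
  (forall t, a < t < b -> p t <= m) -> F b - F a <= m * (b - a).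
Proof.
move=> a0 ab mp; rewrite F_sub// -(mu_oo ab) -Rintegral_cst//.
apply: le_Rintegral; [by []|exact: int_oo|exact: int_cst|].
by move=> t /=; rewrite in_itv/=; exact: mp.
Qed.

Lemma Rintegral_itv00 : F 0 = 0.
Proof. by rewrite /F set_itv1 Rintegral_set1. Qed.

End NondecreasingIntegral.

Section Young.
Context {R : realType}.
Implicit Types p f g : R -> R.

(** Divergence of [p] at infinity is what makes the [sup] in [right_inv] a genuine supremum. *)
Lemma right_inv_bound p (s : R) : orlicz_kernel p ->
  has_ubound [set t | 0 <= t /\ p t <= s].
Proof.
move=> [p_homo _ _ p_oo].
have [M [Mr hM]] := (cvgryPgt p).1 p_oo s.
pose M1 := Num.max M 0 + 1.
have MM1 : M < M1 by rewrite /M1 ltr_pwDr// le_max lexx.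
have M10 : 0 <= M1 by rewrite /M1 addr_ge0// le_max lexx orbT.
exists M1 => t [t0 pt]; rewrite leNgt; apply/negP => M1t.
have := hM _ MM1; rewrite ltNge => /negP; apply; apply: le_trans pt.
by apply: p_homo; rewrite ?in_itv/= ?andbT// ltW.
Qed.

Lemma le_right_inv p (s t : R) : orlicz_kernel p -> 0 <= t -> p t <= s ->
  t <= right_inv p s.
Proof. by move=> pK t0 pt; apply: (ub_le_sup (right_inv_bound s pK)). Qed.

Lemma right_inv_ge0 p (s : R) : orlicz_kernel p -> 0 <= s -> 0 <= right_inv p s.
Proof. by move=> pK s0; apply: le_right_inv => //; case: pK => _ ->. Qed.

Lemma right_inv_gt p (s t : R) : orlicz_kernel p -> 0 <= t ->
  right_inv p s < t -> s < p t.
Proof.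
move=> pK t0; apply: contraTT; rewrite -!leNgt => pt; exact: le_right_inv.
Qed.

Lemma lt_right_inv p (s t : R) : orlicz_kernel p -> 0 <= s -> 0 <= t ->
  t < right_inv p s -> p t <= s.
Proof.
move=> pK s0 t0 tq.
have ne : [set t | 0 <= t /\ p t <= s] !=set0.
  by exists 0; split => //; case: pK => _ ->.
have [u [u0 pu] tu] := sup_gt ne tq.
by apply: le_trans pu; case: pK => + _ _ _; apply; rewrite ?in_itv/= ?andbT// ltW.
Qed.

Lemma right_inv_homo p : orlicz_kernel p ->
  {in `[0, +oo[ &, {homo right_inv p : s t / s <= t}}.
Proof.
move=> pK s t; rewrite !in_itv/= !andbT => s0 t0 st.
apply: ge_sup; first by exists 0; split => //; case: pK => _ ->.
move=> u [u0 pu]; apply: le_right_inv => //; exact: le_trans st.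
Qed.

Section Complementary.
Variables (f g p : R -> R).
Hypothesis pK : orlicz_kernel p.
Hypothesis fE : forall u : R, 0 <= u -> f u = \int[lebesgue_measure]_(t in `[0, u]) p t.
Hypothesis gE : forall v : R, 0 <= v ->
  g v = \int[lebesgue_measure]_(s in `[0, v]) right_inv p s.
Let q := right_inv p.
Let p_homo : {in `[0, +oo[ &, {homo p : s t / s <= t}}. Proof. by case: pK. Qed.

(** [s] is a subgradient of [f] at [q s], since [p] is at most [s] before [q s] and above [s] after
    it. Hence s u - f u is largest at u = q s, and Young's inequality reduces to the bound of that
    maximum by g s. *)
Let f_subgradient s u : 0 <= s -> 0 <= u -> s * (u - q s) <= f u - f (q s).
Proof.
move=> s0 u0; have q0 : 0 <= q s by exact: right_inv_ge0.
have [uq|qu] := leP u (q s).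
  rewrite -lerN2 -mulrN !opprB !fE//.
  apply: (Rintegral_increment_le p_homo) => // t /andP[ut tq].
  by apply: lt_right_inv => //; exact: le_trans (ltW ut).
rewrite !fE//; apply: (Rintegral_increment_ge p_homo) => //; first exact: ltW.
move=> t /andP[qt _]; apply/ltW/right_inv_gt => //; exact: le_trans (ltW qt).
Qed.

Let g_increment s t : 0 <= s -> s <= t -> q s * (t - s) <= g t - g s <= q t * (t - s).
Proof.
move=> s0 st; have t0 := le_trans s0 st; rewrite !gE//; apply/andP; split.
  apply: (Rintegral_increment_ge (right_inv_homo pK)) => // u /andP[su _].
  by apply: right_inv_homo; rewrite ?in_itv/= ?andbT ?(ltW su)// (le_trans s0 (ltW su)).
apply: (Rintegral_increment_le (right_inv_homo pK)) => // u /andP[su ut].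
by apply: right_inv_homo; rewrite ?in_itv/= ?andbT ?(ltW ut)// (le_trans s0 (ltW su)).
Qed.

(* From [s] to [t], the increments of both sides lie between [q s * (t - s)] and
   [q t * (t - s)]; sum over a fine subdivision of [0, v]. *)
Let legendre_le v : 0 <= v -> v * q v - f (q v) <= g v.
Proof.
move=> v0.
have step (n : nat) (k : nat) (h : R) : 0 <= h ->
    let s := k%:R * h in s * q s - f (q s) <= g s + h * (q s - q 0).
  move=> h0 /=; elim: k => [|k IH].
    have g0 : g 0 = 0 by rewrite gE// Rintegral_itv00.
    have : 0 <= f (q 0).
      rewrite fE ?right_inv_ge0//; apply: Rintegral_ge0 => t /=.
      rewrite in_itv/= => /andP[t0 _]; case: pK => _ p0 _ _; rewrite -p0.
      by apply: p_homo; rewrite ?in_itv/= ?lexx ?andbT.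
    by rewrite !mul0r g0 subrr mulr0 !add0r oppr_le0.
  have kh0 : 0 <= k%:R * h by rewrite mulr_ge0.
  have kh1 : 0 <= k.+1%:R * h by rewrite mulr_ge0.
  have kh : k%:R * h <= k.+1%:R * h by rewrite ler_wpM2r// ler_nat.
  have := g_increment kh0 kh; have := f_subgradient kh0 (right_inv_ge0 pK kh1).
  rewrite -/q; move: IH.
  have -> : k.+1%:R * h = k%:R * h + h by rewrite -natr1; ring.
  by move: (k%:R * h) => s; nra.
have q0 : 0 <= q v - q 0.
  by rewrite subr_ge0 right_inv_homo// in_itv/= ?lexx ?andbT.
apply/ler_addgt0Pr => e e0.
(* The per-step errors telescope to (v / n) (q v - q 0); this [n] brings their sum below [e]. *)
pose n := (Num.truncn (v * (q v - q 0) / e)).+1.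
have nC : v * (q v - q 0) / e < n%:R by rewrite truncnS_gt.
have n0 : 0 < n%:R :> R by rewrite ltr0n.
have := @step n n (v / n%:R) (divr_ge0 v0 (ltW n0)).
have vE : n%:R * (v / n%:R) = v by rewrite mulrC divfK ?gt_eqF.
rewrite /= !vE => /le_trans; apply; rewrite lerD2l.
by rewrite mulrAC ler_pdivrMr// -ler_pdivrMl// mulrC ltW.
Qed.

Lemma young u v : 0 <= u -> 0 <= v -> u * v <= f u + g v.
Proof.
move=> u0 v0; have := f_subgradient v0 u0; have := legendre_le v0; nra.
Qed.

Lemma complementary_continuous M : {within `[0, M], continuous g}.
Proof.
apply/subspace_continuousP => x; rewrite /= in_itv/= => /andP[x0 xM].
have M0 := le_trans x0 xM.
have lip s t : 0 <= s -> s <= t -> t <= M -> `|g t - g s| <= q M * (t - s).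
  move=> s0 st tM; have t0 := le_trans s0 st.
  have /andP[g1 g2] := g_increment s0 st.
  have h1 : 0 <= q s by exact: right_inv_ge0.
  have h2 : q t <= q M by apply: right_inv_homo; rewrite ?in_itv/= ?andbT.
  rewrite ger0_norm; first by rewrite (le_trans g2)// ler_wpM2r// subr_ge0.
  by apply: le_trans g1; rewrite mulr_ge0// subr_ge0.
have qM0 : 0 <= q M by exact: right_inv_ge0.
apply/cvgrPdist_le => e e0.
have d0 : 0 < e / (q M + 1) by rewrite divr_gt0// ltr_wpDl.
rewrite near_withinE; near=> y => /=; rewrite in_itv/= => /andP[y0 yM].
have xy : `|x - y| < e / (q M + 1).
  near: y; exact: (@nbhsx_ballx _ R x _ d0).
have : (q M + 1) * `|x - y| <= e.
  by rewrite mulrC -ler_pdivlMr ?ltW// ltr_wpDl.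
apply: le_trans; have [xley|/ltW ylex] := leP x y.
  rewrite distrC (le_trans (lip _ _ x0 xley yM))// distrC ger0_norm ?subr_ge0//; nra.
rewrite (le_trans (lip _ _ y0 ylex xM))// ger0_norm ?subr_ge0//; nra.
Unshelve. all: by end_near.
Qed.

End Complementary.
End Young.

(** * Continuity and subadditivity of real powers *)

Section PowerContinuity.
Context {R : realType}.

Lemma powR_continuous_at (r x : R) : 0 < x -> {for x, continuous (fun t => t `^ r)}.
Proof.
move=> x0; apply: differentiable_continuous; apply/derivable1_diffP.
by apply: derivable_powR; rewrite in_itv/= andbT.
Qed.

Lemma within_powR_continuous (r M : R) : 0 <= r ->
  {within `[0, M], continuous (fun t : R => t `^ r)}.
Proof.
move=> r0; apply/subspace_continuousP => x; rewrite /= in_itv/= => /andP[x0 _].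
(* The exponent 0 is separate: the power is then constantly 1, also at 0. *)
move: r0; rewrite le_eqVlt => /predU1P[<-|r0].
  have -> : (fun t : R => t `^ 0) = cst 1 by apply/funext => t; rewrite powRr0.
  exact: cvg_cst.
move: x0; rewrite le_eqVlt => /predU1P[<-|x0]; last first.
  by apply: cvg_within_filter; exact: powR_continuous_at.
rewrite /from_subspace/= powR0 ?gt_eqF//; apply/cvgrPdist_le => e e0.
have d0 : 0 < e `^ r^-1 by exact: powR_gt0.
rewrite near_withinE; near=> y => /=; rewrite in_itv/= => /andP[y0 _].
rewrite sub0r normrN ger0_norm ?powR_ge0//.
have : `|0 - y| < e `^ r^-1.
  by near: y; exact: (@nbhsx_ballx _ R 0 _ d0).
rewrite sub0r normrN ger0_norm// => /ltW yd.
have := ge0_ler_powR (ltW r0) _ _ yd; rewrite !nnegrE => /(_ y0 (ltW d0)).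
by rewrite -powRrM mulVf ?gt_eqF// powRr1// ltW.
Unshelve. all: by end_near.
Qed.

Lemma within_shifted_powR_continuous (r d M : R) : 0 < d ->
  {within `[0, M], continuous (fun t : R => (t + d) `^ r)}.
Proof.
move=> d0; apply/subspace_continuousP => x; rewrite /= in_itv/= => /andP[x0 _].
apply: cvg_within_filter.
apply: (@continuous_comp _ _ _ (fun t : R => t + d) (fun t => t `^ r)).
  by apply: cvgD => //; exact: cvg_cst.
by apply: powR_continuous_at; rewrite ltr_wpDl.
Qed.

(** A ratio in [0, 1] is at most its r-th power. Apply this to s / (s + t) and t / (s + t), which
    sum to 1. *)
Lemma powRD_subadditive (r s t : R) : 0 <= r <= 1 -> 0 <= s -> 0 < t ->
  (s + t) `^ r <= s `^ r + t `^ r.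
Proof.
move=> /andP[r0 r1] s0 t0; have st0 : 0 < s + t by rewrite ltr_wpDl.
have le x : 0 <= x -> x <= s + t -> x / (s + t) * (s + t) `^ r <= x `^ r.
  move=> x0 xst; move: x0; rewrite le_eqVlt => /predU1P[<-|x0].
    by rewrite !mul0r powR_ge0.
  have -> : x `^ r = (x / (s + t)) `^ r * (s + t) `^ r.
    by rewrite -powRM ?divr_ge0 ?ltW// divfK// gt_eqF.
  rewrite ler_wpM2r ?powR_ge0//; apply: ger1_powR => //.
  by rewrite divr_gt0//= ler_pdivrMr// mul1r.
have h2 := le s s0; have h1 := le t (ltW t0).
have -> : (s + t) `^ r = s / (s + t) * (s + t) `^ r + t / (s + t) * (s + t) `^ r.
  by rewrite -mulrDl -mulrDl mulfV ?gt_eqF// mul1r.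
by apply: lerD; [apply: h2|apply: h1]; lra.
Qed.

End PowerContinuity.

(** * Hilbert spaces *)

Section RealInnerProduct.
Context {R : realType} {H : completeNormedModType R[i]}
  (dot : {dot H for (@Num.conj R[i])}).
Implicit Types u v w : H.

Definition rnorm u : R := complex.Re `|u|.
(** The underlying real inner product, so that estimates live in the ordered field [R]. Nothing is
    lost: the imaginary part of [dot u v] is [rdot u ('i *: v)], see [dot_rdot]. *)
Definition rdot u v : R := complex.Re (dot u v).

Lemma rdotE u v : rdot u v = complex.Re (dot u v).
Proof. by []. Qed.

Lemma normr_rnorm u : `|u| = (rnorm u)%:C.
Proof. by rewrite /rnorm RRe_real// normr_real. Qed.

Lemma rnorm_ge0 u : 0 <= rnorm u.
Proof. by have := normr_ge0 u; rewrite normr_rnorm ler0c. Qed.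

Lemma rnormD u v : rnorm (u + v) <= rnorm u + rnorm v.
Proof. by have := ler_normD u v; rewrite !normr_rnorm -rmorphD lecR. Qed.

Lemma rnormZ (z : R[i]) u : rnorm (z *: u) = complex.Re `|z| * rnorm u.
Proof.
apply: complexI; rewrite -normr_rnorm normrZ normr_rnorm rmorphM/=.
by rewrite RRe_real// normr_real.
Qed.

Lemma rnormN u : rnorm (- u) = rnorm u.
Proof. by rewrite /rnorm normrN. Qed.

Lemma rnormB u v : rnorm (u - v) <= rnorm u + rnorm v.
Proof. by rewrite -(rnormN v) rnormD. Qed.

Lemma rnorm_distC u v : rnorm (u - v) = rnorm (v - u).
Proof. by rewrite -rnormN opprB. Qed.

Lemma rnorm0 : rnorm 0 = 0.
Proof. by rewrite /rnorm normr0. Qed.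

Lemma rnorm_eq0 u : rnorm u = 0 -> u = 0.
Proof. by move=> u0; apply/eqP; rewrite -normr_eq0 normr_rnorm u0. Qed.

Lemma rdotDl u v w : rdot (u + v) w = rdot u w + rdot v w.
Proof. by rewrite /rdot linearDl/= raddfD. Qed.

Lemma rdotDr u v w : rdot u (v + w) = rdot u v + rdot u w.
Proof. by rewrite /rdot linearDr/= raddfD. Qed.

Lemma rdotNl u v : rdot (- u) v = - rdot u v.
Proof. by rewrite /rdot linearNl/= raddfN. Qed.

Lemma rdotNr u v : rdot u (- v) = - rdot u v.
Proof. by rewrite /rdot linearNr/= raddfN. Qed.

Lemma rdotBl u v w : rdot (u - v) w = rdot u w - rdot v w.
Proof. by rewrite rdotDl rdotNl. Qed.

Lemma rdotBr u v w : rdot u (v - w) = rdot u v - rdot u w.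
Proof. by rewrite rdotDr rdotNr. Qed.

Lemma rdotC u v : rdot u v = rdot v u.
Proof.
by rewrite /rdot (hermC dot u v) /= expr0 mul1r; case: (dot v u).
Qed.

Lemma rdotZl (a : R) u v : rdot (a%:C *: u) v = a * rdot u v.
Proof.
by rewrite /rdot linearZl_LR/=; case: (dot u v) => x y /=; rewrite mul0r subr0.
Qed.

Lemma rdotZr (a : R) u v : rdot u (a%:C *: v) = a * rdot u v.
Proof. by rewrite rdotC rdotZl rdotC. Qed.

Lemma rdot0l u : rdot 0 u = 0.
Proof. by rewrite -(subrr 0) rdotBl subrr. Qed.

Lemma dot_rdot u v : dot u v = rdot u v +i* rdot u ('i *: v).
Proof.
rewrite /rdot linearZr_LR/=; case: (dot u v) => x y /=.
by congr (_ +i* _); ring.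
Qed.

Lemma rdot_inj u v : (forall w, rdot w u = rdot w v) -> u = v.
Proof.
move=> h; apply/eqP; rewrite -subr_eq0 -(dnorm_eq0 dot).
rewrite -(RRe_real (ger0_real (dnorm_ge0 dot _))).
by rewrite -/(rdot _ _) rdotBr h subrr.
Qed.

Hypothesis dotE : forall u, `|u| ^+ 2 = dot u u.

Lemma rnorm_sqr u : rnorm u ^+ 2 = rdot u u.
Proof. by rewrite /rdot -dotE normr_rnorm -rmorphXn. Qed.

Lemma rdot_ge0 u : 0 <= rdot u u.
Proof. by rewrite -rnorm_sqr sqr_ge0. Qed.

(** Converts an arithmetic-mean bound into a product bound: when two vectors are rescaled by real
    factors, these factors play the roles of [s] and [t]. The choice s = b, t = c suffices unless b
    = 0. *)
Lemma discriminant_le0 (a b c : R) : 0 <= a -> 0 <= b ->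
  (forall s t : R, 2 * c * s * t <= s ^+ 2 * a + t ^+ 2 * b) -> c ^+ 2 <= a * b.
Proof.
move=> a0 b0 h; move: b0; rewrite le_eqVlt => /predU1P[b0|b0].
  by have := h c (a + 1); rewrite -b0; nra.
have := h b c; rewrite -subr_ge0 => hh.
rewrite -subr_ge0 -(pmulr_lge0 _ b0); apply: le_trans hh _.
by rewrite le_eqVlt; apply/orP; left; apply/eqP; ring.
Qed.

Lemma cauchy_schwarz u v : `|rdot u v| <= rnorm u * rnorm v.
Proof.
rewrite -(@ler_pXn2r _ 2) ?nnegrE ?mulr_ge0 ?rnorm_ge0//.
rewrite real_normK ?num_real// exprMn !rnorm_sqr.
apply: discriminant_le0; rewrite ?rdot_ge0// => s t.
have := rdot_ge0 (s%:C *: u - t%:C *: v).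
by rewrite !rdotBl !rdotBr !rdotZl !rdotZr (rdotC v u); lra.
Qed.

Lemma form_cauchy_schwarz (W : H -> H) u v : linear W ->
  (forall x y, rdot (W x) y = rdot x (W y)) -> (forall x, 0 <= rdot (W x) x) ->
  rdot (W u) v ^+ 2 <= rdot (W u) u * rdot (W v) v.
Proof.
move=> linW symW posW.
pose L : {linear H -> H} := HB.pack W (GRing.isLinear.Build _ _ _ _ W linW).
apply: discriminant_le0 => // s t.
have := posW (s%:C *: u - t%:C *: v).
have -> : W (s%:C *: u - t%:C *: v) = s%:C *: W u - t%:C *: W v.
  by rewrite -[W]/(L : _ -> _) linearB !linearZ.
rewrite !rdotBl !rdotBr !rdotZl !rdotZr (symW v u) (rdotC v); lra.
Qed.

Lemma rnorm_complete (u : nat -> H) :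
  (forall e : R, 0 < e -> exists N, forall m n, (N <= m)%N -> (N <= n)%N ->
     rnorm (u m - u n) <= e) ->
  exists l, forall e : R, 0 < e -> exists N, forall n, (N <= n)%N ->
     rnorm (u n - l) <= e.
Proof.
move=> hu.
have /cauchy_cvgP cu : cauchy (u @ \oo).
  apply/cauchyP => e e0.
  have er : e = (complex.Re e)%:C by rewrite RRe_real// gtr0_real.
  have re0 : 0 < complex.Re e by rewrite -ltcR -er.
  have [N hN] := hu _ (divr_gt0 re0 (ltr0n _ 2)).
  exists (u N); exists N => // n /= Nn; rewrite -ball_normE/=.
  rewrite normr_rnorm er ltcR; apply: le_lt_trans (hN _ _ (leqnn N) Nn) _.
  by rewrite ltr_pdivrMr// ltr_pMr// ltr1n.
exists (lim (u @ \oo)) => e e0.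
have e0c : 0 < e%:C by rewrite ltcR.
move/cvgrPdist_le : cu => /(_ _ e0c)[N _ hN].
exists N => n /hN; rewrite normr_rnorm lecR.
by rewrite rnorm_distC.
Qed.

End RealInnerProduct.

Section SymmetricOperators.
Context {R : realType} {H : completeNormedModType R[i]}
  (dot : {dot H for (@Num.conj R[i])}).
Hypothesis dotE : forall u, `|u| ^+ 2 = dot u u.
Implicit Types (u v w : H) (T S V W : H -> H).
Local Notation rdot := (rdot dot).

Definition bounded_op T :=
  exists2 M : R, 0 <= M & forall u, rnorm (T u) <= M * rnorm u.

(** For a complex-linear [T] this is full self-adjointness, by the same identity applied to
    ['i *: v]. *)
Definition symmetric_op T := forall u v, rdot (T u) v = rdot u (T v).

Definition sop T := [/\ linear T, bounded_op T & symmetric_op T].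

Section Linear.
Variables (T : H -> H) (linT : linear T).
Let L : {linear H -> H} := HB.pack T (GRing.isLinear.Build _ _ _ _ T linT).

Lemma op0 : T 0 = 0. Proof. exact: (linear0 L). Qed.
Lemma opD u v : T (u + v) = T u + T v. Proof. exact: (linearD L). Qed.
Lemma opB u v : T (u - v) = T u - T v. Proof. exact: (linearB L). Qed.
Lemma opZ a u : T (a *: u) = a *: T u. Proof. exact: (linearZZ L). Qed.

Lemma bounded_op_continuous : bounded_op T -> continuous T.
Proof.
move=> [M M0 hM] u; apply/cvgrPdist_le => e e0.
have er : e = (complex.Re e)%:C by rewrite RRe_real// gtr0_real.
have re0 : 0 < complex.Re e by rewrite -ltcR -er.
have d0 : 0 < (complex.Re e / (M + 1))%:C by rewrite ltcR divr_gt0// ltr_wpDl.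
near=> v; rewrite -opB normr_rnorm er lecR; apply: le_trans (hM _) _.
have : `|u - v| < (complex.Re e / (M + 1))%:C.
  near: v; apply/nbhs_ballP; exists (complex.Re e / (M + 1))%:C => // v.
  by rewrite -ball_normE.
rewrite normr_rnorm ltcR ltr_pdivlMr ?ltr_wpDl// => /ltW; apply: le_trans.
by have := rnorm_ge0 (u - v); nra.
Unshelve. all: by end_near.
Qed.

Lemma continuous_bounded_op : continuous T -> bounded_op T.
Proof.
move=> cT; have /(@continuous_linear_bounded _ _ _ _ L) /linear_boundedP := cT 0.
move=> [y [yr hy]].
have y1 : y < `|y| + 1.
  by rewrite (le_lt_trans (real_ler_norm yr))// ltrDl.
have yE : (complex.Re (`|y| + 1))%:C = `|y| + 1.
  by rewrite RRe_real// rpredD ?normr_real.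
exists (complex.Re (`|y| + 1)); first by rewrite -ler0c yE addr_ge0.
move=> u; rewrite -lecR -normr_rnorm.
have -> : (complex.Re (`|y| + 1) * rnorm u)%:C = (`|y| + 1) * `|u|.
  by rewrite normr_rnorm -yE -rmorphM.
exact: hy.
Qed.

End Linear.

Lemma bounded_op_comp T S : bounded_op T -> bounded_op S -> bounded_op (T \o S).
Proof.
move=> [M M0 hM] [N N0 hN]; exists (M * N); first exact: mulr_ge0.
by move=> u /=; rewrite (le_trans (hM _))// -mulrA ler_wpM2l.
Qed.

Lemma bounded_opD T S : bounded_op T -> bounded_op S ->
  bounded_op (fun u => T u + S u).
Proof.
move=> [M M0 hM] [N N0 hN]; exists (M + N); first exact: addr_ge0.
by move=> u /=; rewrite (le_trans (rnormD _ _))// mulrDl lerD.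
Qed.

Lemma bounded_opZ z : bounded_op (fun u => z *: u).
Proof.
exists (complex.Re `|z|); last by move=> u; rewrite rnormZ.
by rewrite -ler0c RRe_real ?normr_real.
Qed.

Lemma linear_comp T S : linear T -> linear S -> linear (T \o S).
Proof. by move=> lT lS a u v /=; rewrite lS lT. Qed.

Lemma rdot_bound T M u : (forall u, rnorm (T u) <= M * rnorm u) ->
  `|rdot (T u) u| <= M * rnorm u ^+ 2.
Proof.
move=> hM; apply: le_trans (cauchy_schwarz dotE _ _) _.
by rewrite expr2 mulrA ler_wpM2r ?rnorm_ge0.
Qed.

Lemma quadratic_ge0 (a b c : R) : 0 <= a ->
  (forall t, 0 <= a * t ^+ 2 + 2 * b * t + c) -> b ^+ 2 <= a * c.
Proof.
move=> a0 h; have c0 : 0 <= c by have := h 0; rewrite expr0n/= !mulr0 !add0r.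
move: a0; rewrite le_eqVlt => /predU1P[aE|a0].
  have [->|b0] := eqVneq b 0; first by rewrite -aE mul0r expr0n.
  have := h (- (c + 1) / (2 * b)); rewrite -aE mul0r add0r.
  have -> : 2 * b * (- (c + 1) / (2 * b)) = - (c + 1) by field.
  lra.
have := h (- b / a).
have -> : a * (- b / a) ^+ 2 + 2 * b * (- b / a) + c = c - b ^+ 2 / a.
  by field; rewrite gt_eqF.
by rewrite subr_ge0 ler_pdivrMr// mulrC.
Qed.

(** * Symmetric Lax-Milgram theorem by energy minimisation *)

Section LaxMilgram.
Variables (W : H -> H) (c : R) (phi : H -> R).
Hypotheses (sW : sop W) (c0 : 0 < c).
Hypothesis coerW : forall u, c * rnorm u ^+ 2 <= rdot (W u) u.
Hypothesis phiD : forall u v, phi (u + v) = phi u + phi v.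
Hypothesis phiZ : forall (a : R) u, phi (a%:C *: u) = a * phi u.
Hypothesis phi_bounded : exists2 K : R, 0 <= K & forall u, `|phi u| <= K * rnorm u.

(** The energy whose critical points solve the equation [W u = phi] weakly. *)
Let J u := rdot (W u) u - 2 * phi u.

Let JD u v (t : R) : J (u + t%:C *: v) =
  rdot (W v) v * t ^+ 2 + 2 * (rdot (W u) v - phi v) * t + J u.
Proof.
case: sW => lW _ syW.
rewrite /J phiD phiZ (opD lW) (opZ lW) !rdotDl !rdotDr !rdotZl !rdotZr.
by rewrite (syW v u) (rdotC _ v (W u)); ring.
Qed.

Let J_lb : has_lbound [set J u | u in setT].
Proof.
case: phi_bounded => K K0 hK; exists (- (K ^+ 2 / c)) => _ [u _ <-].
have := coerW u; have := ler_norm (phi u); have := hK u; rewrite /J.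
have : 0 <= (c * rnorm u - K) ^+ 2 / c by rewrite divr_ge0 ?sqr_ge0 ?ltW.
have -> : (c * rnorm u - K) ^+ 2 / c =
  c * rnorm u ^+ 2 - 2 * K * rnorm u + K ^+ 2 / c by field; rewrite gt_eqF.
by move: (K ^+ 2 / c) => x; nra.
Qed.

(** A minimising sequence of [J] converges by coercivity, and its limit is critical. With W = id
    this is the Riesz representation that yields adjoints; for general [W] it makes coercive
    operators surjective. *)
Lemma lax_milgram : exists u, forall v, rdot (W u) v = phi v.
Proof.
pose d := inf [set J u | u in setT].
have dJ u : d <= J u by apply: (ge_inf J_lb); exists u.
have /choice[u hu] : forall n : nat, exists u, J u <= d + n.+1%:R^-1.
  move=> n.
  have n0 : 0 < n.+1%:R^-1 :> R by rewrite invr_gt0.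
  have [|_ [v _ <-] hv] := @inf_adherent _ [set J u | u in setT] _ n0.
    by split; [exists (J 0); exists 0|exact: J_lb].
  by exists v; exact: ltW.
(* For every real t, J (u n + t v) >= d >= J (u n) - 1 / (n + 1); the quadratic in t has a
   nonpositive discriminant. *)
have grad n v : (rdot (W (u n)) v - phi v) ^+ 2 <= rdot (W v) v * n.+1%:R^-1.
  apply: quadratic_ge0; first by rewrite (le_trans _ (coerW v))// mulr_ge0 ?sqr_ge0// ltW.
  move=> t; have := dJ (u n + t%:C *: v); have := hu n; rewrite JD.
  move: (_^-1) (J _) (rdot _ _) (rdot _ _ - _) => a b x y; lra.
(* Parallelogram argument: compare the energies at [u m], at [u n] and at their midpoint, which is
   still at least [d]. *)
have cauchy_u m n : c / 2 * rnorm (u m - u n) ^+ 2 <= m.+1%:R^-1 + n.+1%:R^-1.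
  have [lW _ syW] := sW.
  have := dJ (u n + (2^-1)%:C *: (u m - u n)); rewrite JD.
  have := coerW (u m - u n); have := hu m; have := hu n.
  have -> : J (u m) = J (u n + 1%:C *: (u m - u n)).
    by rewrite scale1r addrC subrK.
  rewrite JD.
  move: (rdot (W (u n)) _ - _) (m.+1%:R^-1) (n.+1%:R^-1) (J _) => b y z j.
  by move: (rdot _ _) (rnorm _ ^+ 2) => a r; lra.
have [l hl] : exists l, forall e : R, 0 < e -> exists N, forall n, (N <= n)%N ->
     rnorm (u n - l) <= e.
  apply: rnorm_complete => e e0.
  have e1 : 0 < c / 4 * e ^+ 2 by rewrite mulr_gt0 ?exprn_gt0 ?divr_gt0.
  pose N := Num.truncn (c / 4 * e ^+ 2)^-1.
  have hN k : (N <= k)%N -> k.+1%:R^-1 <= c / 4 * e ^+ 2.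
    move=> Nk; rewrite -[leRHS]invrK lef_pV2 ?posrE ?invr_gt0//.
    by rewrite (le_trans (ltW (truncnS_gt _)))// ler_nat.
  exists N => m n /hN hm /hN hn; rewrite -(@ler_pXn2r _ 2) ?nnegrE ?rnorm_ge0 ?(ltW e0)//.
  rewrite -(ler_pM2l (divr_gt0 c0 (ltr0n _ 2))).
  by have := cauchy_u m n; move: (m.+1%:R^-1) (n.+1%:R^-1) hm hn => a b; lra.
exists l => v; apply/eqP; rewrite -subr_eq0 -sqrf_eq0.
rewrite eq_le sqr_ge0 andbT; apply/ler_addgt0Pr => e e0; rewrite add0r.
have [lW [M M0 hM] _] := sW.
pose A := rdot (W v) v; have A0 : 0 <= A.
  by rewrite (le_trans _ (coerW v))// mulr_ge0 ?sqr_ge0// ltW.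
pose B := (M * rnorm v) ^+ 2; have B0 : 0 <= B by exact: sqr_ge0.
(* The squared residual is at most 2 B x, from the distance of [u n] to [l], plus 2 A x, from the
   gradient at [u n]; this is at most [e]. *)
pose x := e / (2 * (A + B + 1)).
have AB0 : 0 < 2 * (A + B + 1) by lra.
have x0 : 0 < x by rewrite divr_gt0.
have sx0 : 0 < Num.sqrt x by rewrite sqrtr_gt0.
have [N hN] := hl _ sx0.
pose n := maxn N (Num.truncn x^-1).
have h1 : rnorm (u n - l) ^+ 2 <= x.
  by rewrite -(sqr_sqrtr (ltW x0)) lerXn2r ?nnegrE ?rnorm_ge0 ?sqrtr_ge0// hN// leq_maxl.
have h2 : n.+1%:R^-1 <= x.
  rewrite -[leRHS]invrK lef_pV2 ?posrE ?invr_gt0//.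
  by rewrite (le_trans (ltW (truncnS_gt _)))// ler_nat ltnS leq_maxr.
have h3 : rdot (W (u n - l)) v ^+ 2 <= B * x.
  rewrite -real_normK ?num_real//.
  apply: (@le_trans _ _ ((M * rnorm (u n - l) * rnorm v) ^+ 2)).
    rewrite lerXn2r ?nnegrE ?mulr_ge0 ?rnorm_ge0//.
    by rewrite (le_trans (cauchy_schwarz dotE _ _))// ler_wpM2r ?rnorm_ge0.
  by rewrite mulrAC exprMn ler_wpM2l.
have h4 := grad n v; rewrite -/A in h4.
have h5 : A * n.+1%:R^-1 <= A * x by rewrite ler_wpM2l.
rewrite (opB lW) rdotBl in h3.
have xE : 2 * (A + B + 1) * x = e by rewrite /x mulrC divfK// gt_eqF.
have h6 := le_trans h4 h5.
move: h3 h6 xE x0; move: (rdot (W (u n)) v) (rdot (W l) v) (phi v) => y z f.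
have : (z - f) ^+ 2 <= 2 * (y - z) ^+ 2 + 2 * (y - f) ^+ 2.
  by have := sqr_ge0 ((y - z) + (y - f)); lra.
lra.
Qed.

End LaxMilgram.
End SymmetricOperators.

(** * Adjoints, spectra and polynomial calculus *)

Section AdjointInverse.
Context {R : realType} {H : completeNormedModType R[i]}
  (dot : {dot H for (@Num.conj R[i])}).
Hypothesis dotE : forall u, `|u| ^+ 2 = dot u u.
Implicit Types (u v w : H) (T S V W : H -> H).
Local Notation rdot := (rdot dot).
Local Notation sop := (sop dot).

Lemma rdot_iC u v : rdot u ('i *: v) = - rdot ('i *: u) v.
Proof.
rewrite !rdotE linearZr_LR/= linearZl_LR/=; case: (dot u v) => x y /=.
by ring.
Qed.

(** Riesz representation of u |-> rdot (T u) v gives the identity on real parts; replacing u by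
    ['i *: u] gives the imaginary parts. *)
Lemma adjointP T : linear T -> bounded_op T ->
  forall u v, dot (T u) v = dot u (adjoint dot T v).
Proof.
move=> linT [M M0 hM].
have id_sop : sop id.
  by split => //; exists 1 => // u; rewrite mul1r.
have /choice[S hS] : forall v, exists w, forall u, rdot (T u) v = rdot u w.
  move=> v.
  have [|||||w hw] := @lax_milgram _ _ dot dotE id 1 (fun u => rdot (T u) v) id_sop.
  - exact: ltr01.
  - by move=> u; rewrite mul1r (rnorm_sqr dotE).
  - by move=> u w; rewrite (opD linT) rdotDl.
  - by move=> a u; rewrite (opZ linT) rdotZl.
  - exists (M * rnorm v); first by rewrite mulr_ge0 ?rnorm_ge0.
    move=> u; rewrite (le_trans (cauchy_schwarz dotE _ _))// mulrAC.
    by rewrite ler_wpM2r ?rnorm_ge0.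
  - by exists w => u; rewrite [RHS]rdotC; exact/esym/hw.
have hdot : forall u v, dot (T u) v = dot u (S v).
  move=> u v; rewrite !dot_rdot hS; congr (_ +i* _).
  by rewrite !rdot_iC -(opZ linT) hS.
by rewrite /adjoint; case: xgetP => [S' _ //|/(_ S) /= []].
Qed.

Lemma adjoint_unique T S : (forall u v, dot (T u) v = dot u (S v)) ->
  linear T -> bounded_op T -> adjoint dot T = S.
Proof.
move=> hS linT bT; apply/funext => v; apply: (@rdot_inj _ _ dot) => w.
by rewrite !rdotE -adjointP// hS.
Qed.

Lemma adjoint_linear T : linear T -> bounded_op T -> linear (adjoint dot T).
Proof.
move=> linT bT a u v; apply: (@rdot_inj _ _ dot) => w.
rewrite !rdotE -adjointP// !linearDr/= !linearZr_LR/=.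
by rewrite -!adjointP.
Qed.

Lemma adjoint_bounded T : linear T -> bounded_op T -> bounded_op (adjoint dot T).
Proof.
move=> linT bT; have [M M0 hM] := bT; exists M => // u.
set v := adjoint dot T u.
have : rnorm v * rnorm v <= M * rnorm u * rnorm v.
  rewrite -expr2 (rnorm_sqr dotE) {2}/v !rdotE -adjointP//.
  apply: le_trans (ler_norm _) _; apply: le_trans (cauchy_schwarz dotE _ _) _.
  by rewrite mulrAC ler_wpM2r ?rnorm_ge0.
have := rnorm_ge0 v; rewrite le_eqVlt => /predU1P[<- _|v0].
  by rewrite mulr_ge0 ?rnorm_ge0.
by rewrite ler_pM2r.
Qed.

Lemma adjointK T : linear T -> bounded_op T -> adjoint dot (adjoint dot T) = T.
Proof.
move=> linT bT; apply: adjoint_unique.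
- move=> u v; rewrite (hermC dot _ v) (hermC dot u) /= expr0 !mul1r.
  by rewrite (adjointP linT bT).
- exact: adjoint_linear.
- exact: adjoint_bounded.
Qed.

Definition invertible_op W :=
  exists V, [/\ linear V, bounded_op V, cancel W V & cancel V W].

Lemma cancel_linear W V : linear W -> cancel W V -> cancel V W -> linear V.
Proof. by move=> linW WV VW a u v; rewrite -{1}(VW u) -{1}(VW v) -linW WV. Qed.

Lemma coercive_invertible W (c : R) : sop W -> 0 < c ->
  (forall u, c * rnorm u ^+ 2 <= rdot (W u) u) -> invertible_op W.
Proof.
move=> sW c0 coer; have [linW bW symW] := sW.
have /choice[V hV] : forall w, exists u, W u = w.
  move=> w.
  have [|||u hu] := @lax_milgram _ _ dot dotE W c (fun u => rdot u w) sW c0 coer.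
  - by move=> u v; rewrite rdotDl.
  - by move=> a u; rewrite rdotZl.
  - exists (rnorm w); first exact: rnorm_ge0.
    by move=> u; rewrite mulrC (cauchy_schwarz dotE).
  - by exists u; apply: (@rdot_inj _ _ dot) => v; rewrite rdotC; exact: hu.
have bnd u : c * rnorm u <= rnorm (W u).
  have := rnorm_ge0 u; rewrite le_eqVlt => /predU1P[<-|u0].
    by rewrite mulr0 rnorm_ge0.
  rewrite -(ler_pM2r u0) -mulrA -expr2; apply: le_trans (coer u) _.
  exact: le_trans (ler_norm _) (cauchy_schwarz dotE _ _).
have inj : injective W.
  move=> u v uv; apply/eqP; rewrite -subr_eq0; apply/eqP/rnorm_eq0/le_anti.
  rewrite rnorm_ge0 andbT -(ler_pM2l c0) mulr0 (le_trans (bnd _))//.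
  by rewrite (opB linW) uv subrr rnorm0.
have WV : cancel W V by move=> u; apply: inj; rewrite hV.
exists V; split => //; first exact: cancel_linear linW WV hV.
exists c^-1; first by rewrite invr_ge0 ltW.
by move=> u; rewrite ler_pdivlMl// (le_trans (bnd _))// hV.
Qed.

Lemma invertible_comp W1 W2 : invertible_op W1 -> invertible_op W2 ->
  invertible_op (W1 \o W2).
Proof.
move=> [V1 [l1 b1 c1 d1]] [V2 [l2 b2 c2 d2]]; exists (V2 \o V1); split.
- exact: linear_comp.
- exact: bounded_op_comp.
- by move=> u /=; rewrite c1 c2.
- by move=> u /=; rewrite d2 d1.
Qed.

(** If [V] inverts the product, [A] commutes with [V] because it commutes with the product, so B V
    is a two-sided inverse of [A]. *)
Lemma invertible_factor A B : linear A -> linear B -> bounded_op B ->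
  A \o B = B \o A -> invertible_op (A \o B) -> invertible_op A.
Proof.
move=> linA linB bB AB [V [lV bV WV VW]].
have ABE u : A (B u) = B (A u) by rewrite -[LHS]/((A \o B) u) AB.
have VA u : V (A u) = A (V u).
  by rewrite -{1}(VW u) /= ABE; exact: WV.
exists (B \o V); split.
- exact: linear_comp.
- exact: bounded_op_comp.
- by move=> u /=; rewrite VA -ABE; exact: VW.
- by move=> u /=; exact: VW.
Qed.

Lemma notin_spectrum T z : linear T ->
  ~ spectrum T z <-> invertible_op (fun u => T u - z *: u).
Proof.
move=> linT; split => [/contrapT[S [lS cS WS SW]]|[V [lV bV WV VW]]].
  by exists S; split => //; exact: continuous_bounded_op.
by apply; exists V; split => //; exact: bounded_op_continuous.
Qed.

Lemma sopD T S : sop T -> sop S -> sop (fun u => T u + S u).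
Proof.
move=> [lT bT sT] [lS bS sS]; split.
- by move=> a u v; rewrite lT lS scalerDr addrACA.
- exact: bounded_opD.
- by move=> u v; rewrite rdotDl rdotDr sT sS.
Qed.

Lemma sop_scale (a : R) : sop (fun u => a%:C *: u).
Proof.
split; last by move=> u v; rewrite rdotZl rdotZr.
- by move=> b u v; rewrite scalerDr !scalerA mulrC.
- exact: bounded_opZ.
Qed.

Lemma sop_comp T S : sop T -> sop S -> T \o S = S \o T -> sop (T \o S).
Proof.
move=> [lT bT sT] [lS bS sS] TS; split.
- exact: linear_comp.
- exact: bounded_op_comp.
- by move=> u v; rewrite /= sT sS -[S (T v)]/((S \o T) v) -TS.
Qed.

End AdjointInverse.

(** * Polynomials in a self-adjoint operator, and positivity on the spectrum *)

Section PolynomialCalculus.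
Context {R : realType} {H : completeNormedModType R[i]}
  (dot : {dot H for (@Num.conj R[i])}).
Hypothesis dotE : forall u, `|u| ^+ 2 = dot u u.
Implicit Types (u v w : H) (r : {poly R}) (q : {poly R[i]}).
Local Notation rdot := (rdot dot).
Local Notation sop := (sop dot).

(** Complex coefficients are needed to split a real polynomial into linear factors. *)
Definition cpoly_op q (T : H -> H) u := \sum_(i < size q) q`_i *: iter i T u.

Lemma cpoly_op_widen q (T : H -> H) n u : (size q <= n)%N ->
  cpoly_op q T u = \sum_(i < n) q`_i *: iter i T u.
Proof.
move=> qn; rewrite /cpoly_op.
have /= -> := big_ord_widen n (fun i => q`_i *: iter i T u) qn.
rewrite big_mkcond/=; apply: eq_bigr => i _; case: ltnP => // qi.
by rewrite nth_default// scale0r.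
Qed.

Lemma poly_op_cpoly r (T : H -> H) :
  poly_op r T = cpoly_op (map_poly (real_complex R) r) T.
Proof.
apply/funext => u; rewrite /cpoly_op size_map_poly.
by apply: eq_bigr => i _; rewrite coef_map.
Qed.

Section CPoly.
Variables (T : H -> H) (linT : linear T).

Lemma cpoly_opC c u : cpoly_op c%:P T u = c *: u.
Proof.
rewrite (@cpoly_op_widen _ _ 1) ?size_polyC_leq1// big_ord1 coefC eqxx//.
Qed.

Lemma cpoly_opD p q u : cpoly_op (p + q) T u = cpoly_op p T u + cpoly_op q T u.
Proof.
pose n := maxn (size p) (size q).
rewrite !(@cpoly_op_widen _ _ n) ?leq_maxl ?leq_maxr ?size_polyD//.
by rewrite -big_split/=; apply: eq_bigr => i _; rewrite coefD scalerDl.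
Qed.

Lemma cpoly_opMX q u : cpoly_op (q * 'X) T u = cpoly_op q T (T u).
Proof.
rewrite (@cpoly_op_widen _ _ (size q).+1); last first.
  by rewrite (leq_trans (size_polyMleq _ _))// size_polyX addn2.
rewrite big_ord_recl coefMX eqxx scale0r add0r; apply: eq_bigr => i _.
by rewrite coefMX/= -iterS iterSr.
Qed.

Lemma cpoly_op_comm q u : cpoly_op q T (T u) = T (cpoly_op q T u).
Proof.
elim/poly_ind: q u => [|q c IH] u.
  by rewrite -polyC0 !cpoly_opC !scale0r (op0 linT).
by rewrite !cpoly_opD !cpoly_opMX !cpoly_opC !IH (opD linT) (opZ linT).
Qed.

Lemma cpoly_op_linear q : linear (cpoly_op q T).
Proof.
elim/poly_ind: q => [|q c IH] a u v.
  by rewrite -polyC0 !cpoly_opC !scale0r scaler0 addr0.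
rewrite !cpoly_opD !cpoly_opMX !cpoly_opC linT IH.
by rewrite !scalerDr !scalerA [c * a]mulrC addrACA.
Qed.

Lemma cpoly_opM p q u : cpoly_op (p * q) T u = cpoly_op p T (cpoly_op q T u).
Proof.
elim/poly_ind: p u => [|p c IH] u.
  by rewrite mul0r -polyC0 !cpoly_opC !scale0r.
rewrite mulrDl cpoly_opD -mulrA [_ * q]mulrC mulrA cpoly_opMX IH cpoly_op_comm.
rewrite cpoly_opD cpoly_opMX cpoly_opC; congr (_ + _).
elim/poly_ind: q u {IH} => [|q d IH] u.
  by rewrite mulr0 -polyC0 !cpoly_opC scale0r scaler0.
rewrite mulrDr mulrA cpoly_opD cpoly_opMX IH -polyCM cpoly_opC.
by rewrite cpoly_opD cpoly_opMX cpoly_opC scalerDr scalerA.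
Qed.

Lemma cpoly_op_bounded q : bounded_op T -> bounded_op (cpoly_op q T).
Proof.
move=> bT; elim/poly_ind: q => [|q c IH].
  by exists 0 => // u; rewrite -polyC0 cpoly_opC scale0r rnorm0 mul0r.
have -> : cpoly_op (q * 'X + c%:P) T =
    fun u => (cpoly_op q T \o T) u + c *: u.
  by apply/funext => u; rewrite cpoly_opD cpoly_opMX cpoly_opC.
by apply: bounded_opD; [exact: bounded_op_comp|exact: bounded_opZ].
Qed.

Lemma cpoly_op_XsubC z : (fun u => T u - z *: u) = cpoly_op ('X - z%:P) T.
Proof.
apply/funext => u; rewrite -polyCN cpoly_opD -['X]mul1r -polyC1 cpoly_opMX.
by rewrite !cpoly_opC scale1r scaleNr.
Qed.

Lemma poly_opC (c : R) u : poly_op c%:P T u = c%:C *: u.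
Proof. by rewrite poly_op_cpoly map_polyC cpoly_opC. Qed.

Lemma poly_opX u : poly_op 'X T u = T u.
Proof.
by rewrite poly_op_cpoly map_polyX -['X]mul1r -polyC1 cpoly_opMX cpoly_opC scale1r.
Qed.

Lemma poly_opD r s u : poly_op (r + s) T u = poly_op r T u + poly_op s T u.
Proof. by rewrite !poly_op_cpoly rmorphD/= cpoly_opD. Qed.

Lemma poly_opM r s u : poly_op (r * s) T u = poly_op r T (poly_op s T u).
Proof. by rewrite !poly_op_cpoly rmorphM/= cpoly_opM. Qed.

Lemma poly_opZ (c : R) r u : poly_op (c *: r) T u = c%:C *: poly_op r T u.
Proof. by rewrite -mul_polyC poly_opM poly_opC. Qed.

Lemma poly_opN r u : poly_op (- r) T u = - poly_op r T u.
Proof. by rewrite -scaleN1r poly_opZ rmorphN1 scaleN1r. Qed.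

Lemma poly_opB r s u : poly_op (r - s) T u = poly_op r T u - poly_op s T u.
Proof. by rewrite poly_opD poly_opN. Qed.

End CPoly.

Lemma sop_poly T r : sop T -> sop (poly_op r T).
Proof.
move=> sT; have [lT bT syT] := sT; elim/poly_ind: r => [|r c IH].
  have -> : poly_op 0 T = fun u : H => 0%:C *: u.
    by apply/funext => u; rewrite -polyC0 poly_opC.
  exact: sop_scale.
have -> : poly_op (r * 'X + c%:P) T = fun u => (poly_op r T \o T) u + c%:C *: u.
  by apply/funext => u; rewrite poly_opD poly_opM// poly_opX poly_opC.
apply: sopD; last exact: sop_scale.
apply: sop_comp => //; apply/funext => u /=.
by rewrite poly_op_cpoly cpoly_op_comm.
Qed.

(** For z = a + i b, the product of T - z and its conjugate factor is (T - a)^2 + b^2, which is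
    coercive with constant b^2; invertibility passes from the product to the factor. *)
Lemma nonreal_invertible T z : sop T -> complex.Im z != 0 ->
  invertible_op (fun u => T u - z *: u).
Proof.
case: z => a b /= sT b0; have [lT bT syT] := sT.
pose r : {poly R} := ('X - a%:P) * ('X - a%:P) + (b * b)%:P.
have rE : ('X - (a +i* b)%:P) * ('X - (a -i* b)%:P) = map_poly (real_complex R) r.
  rewrite rmorphD rmorphM rmorphB/= map_polyX !map_polyC/=.
  have zE c : (a +i* c) = a%:C + 'i * c%:C by simpc.
  have -> : (b * b)%:C = - ('i * b%:C) * ('i * b%:C) :> R[i] by simpc.
  rewrite !zE rmorphN mulrN !(polyCD, polyCM, polyCN).
  by ring.
rewrite cpoly_op_XsubC.
apply: (@invertible_factor _ _ _ (cpoly_op ('X - (a -i* b)%:P) T)).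
- exact: cpoly_op_linear.
- exact: cpoly_op_linear.
- exact: cpoly_op_bounded.
- by apply/funext => u /=; rewrite -!cpoly_opM// mulrC.
rewrite (_ : _ \o _ = poly_op r T); last first.
  by apply/funext => u /=; rewrite -cpoly_opM// rE poly_op_cpoly.
apply: (@coercive_invertible _ _ _ dotE _ (b * b)); first exact: sop_poly.
  by rewrite -expr2 exprn_even_gt0.
move=> u; rewrite poly_opD poly_opM// poly_opC rdotDl rdotZl (rnorm_sqr dotE) lerDr.
have [_ _ ->] := sop_poly ('X - a%:P) sT.
by rewrite (rdot_ge0 dotE).
Qed.

(** Every complex root of [r] gives an invertible factor: a nonreal one by [nonreal_invertible], a
    real one because it lies off the spectrum. *)
Lemma poly_op_invertible T r : sop T -> (1 < size r)%N ->
  (forall t : R, spectrum T t%:C -> r.[t] != 0) -> invertible_op (poly_op r T).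
Proof.
move=> sT r1 hr; have [lT bT syT] := sT.
rewrite poly_op_cpoly; set q := map_poly _ r.
have q0 : q != 0 by rewrite map_poly_eq0 -size_poly_gt0 (ltn_trans _ r1).
have [s qE] := closed_field_poly_normal q.
have invC c : c != 0 -> invertible_op (cpoly_op c%:P T).
  move=> c0; exists (fun u => c^-1 *: u); split.
  - by move=> d u v; rewrite scalerDr !scalerA mulrC.
  - exact: bounded_opZ.
  - by move=> u; rewrite cpoly_opC scalerA mulVf// scale1r.
  - by move=> u; rewrite cpoly_opC scalerA mulfV// scale1r.
have roots z : z \in s -> invertible_op (cpoly_op ('X - z%:P) T).
  move=> zs; have qz : root q z.
    by rewrite qE rootZ ?lead_coef_eq0// root_prod_XsubC.
  rewrite -cpoly_op_XsubC.
  have [zr|] := eqVneq (complex.Im z) 0; last exact: nonreal_invertible.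
  have zE : z = (complex.Re z)%:C by case: (z) zr => x y /= ->.
  apply/notin_spectrum => //; rewrite zE => /hr/negP; apply.
  by move: qz; rewrite zE /q /root horner_map fmorph_eq0.
rewrite qE -mul_polyC.
have -> : cpoly_op ((lead_coef q)%:P * \prod_(z <- s) ('X - z%:P)) T =
    cpoly_op (lead_coef q)%:P T \o cpoly_op (\prod_(z <- s) ('X - z%:P)) T.
  by apply/funext => u; rewrite cpoly_opM.
apply: invertible_comp; first by apply: invC; rewrite lead_coef_eq0.
elim: s roots {qE} => [|z s IH] roots.
  by rewrite big_nil -polyC1; exact/invC/oner_neq0.
rewrite big_cons.
have -> : cpoly_op (('X - z%:P) * \prod_(z <- s) ('X - z%:P)) T =
    cpoly_op ('X - z%:P) T \o cpoly_op (\prod_(z <- s) ('X - z%:P)) T.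
  by apply/funext => u; rewrite cpoly_opM.
apply: invertible_comp; first by apply: roots; rewrite mem_head.
by apply: IH => x xs; apply: roots; rewrite in_cons xs orbT.
Qed.

(* [r] is not constant so that [r - m] below is not [0] even if the spectrum is
   empty, which is not excluded here. *)
Let spectral_ge0_nonconst T r u : sop T -> (1 < size r)%N ->
  (forall t : R, spectrum T t%:C -> 0 <= r.[t]) -> 0 <= rdot (poly_op r T u) u.
Proof.
move=> sT r1 hr; have [lT bT syT] := sT.
have [-> | u0] := eqVneq u 0; first by rewrite rdotC rdot0l.
have nu0 : 0 < rnorm u ^+ 2.
  rewrite exprn_gt0// lt_neqAle rnorm_ge0 andbT eq_sym.
  by apply: contra_neq u0; exact: rnorm_eq0.
set S := poly_op r T; have sS : sop S by exact: sop_poly.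
pose E := [set c : R | forall v, c * rnorm v ^+ 2 <= rdot (S v) v].
have E_ub : has_ubound E.
  by exists (rdot (S u) u / rnorm u ^+ 2) => c /(_ u); rewrite ler_pdivlMr.
have E_ne : E !=set0.
  have [_ [M M0 hM] _] := sS; exists (- M) => v.
  by have := rdot_bound dotE v hM; rewrite ler_norml mulNr => /andP[].
pose m := sup E.
have mE : E m.
  move=> v; have := rnorm_ge0 v; rewrite le_eqVlt => /predU1P[v0|v0].
    have -> : v = 0 by exact: rnorm_eq0.
    by rewrite rnorm0 expr0n/= mulr0 rdotC rdot0l.
  rewrite -ler_pdivlMr ?exprn_gt0//; apply: ge_sup => // c /(_ v).
  by rewrite ler_pdivlMr ?exprn_gt0.
have [m0|m0] := leP 0 m.
  by apply: le_trans (mE u); rewrite mulr_ge0 ?sqr_ge0.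
pose q := r - m%:P.
have qE v : poly_op q T v = S v - m%:C *: v.
  by rewrite poly_opB// poly_opC.
have [V [lV [K K0 hK] WV VW]] : invertible_op (poly_op q T).
  apply: poly_op_invertible => //.
    by rewrite /q size_polyDl// size_polyN (leq_ltn_trans (size_polyC_leq1 _)).
  by move=> t /hr rt; rewrite !hornerE gt_eqF//; lra.
have sW : sop (poly_op q T) by exact: sop_poly.
have [lW [N N0 hN] syW] := sW.
have posW v : 0 <= rdot (poly_op q T v) v.
  by rewrite qE rdotBl rdotZl -(rnorm_sqr dotE) subr_ge0; exact: mE.
(* Cauchy-Schwarz for the form of W = q(T), applied to v and w = W v, bounds |w|^4 by <w, v> <W w,
   w>, hence by N <w, v> |w|^2. *)
have Wsqr v : rnorm (poly_op q T v) ^+ 2 <= N * rdot (poly_op q T v) v.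
  set w := poly_op q T v.
  have := form_cauchy_schwarz v w lW syW posW.
  rewrite -/w -(rnorm_sqr dotE) => h.
  have := rnorm_ge0 w; rewrite le_eqVlt => /predU1P[<-|w0].
    by rewrite expr0n/= mulr_ge0 ?posW.
  have h2 := le_trans (ler_norm _) (rdot_bound dotE w hN).
  have h3 : rnorm w ^+ 2 * rnorm w ^+ 2 <= rdot w v * N * rnorm w ^+ 2.
    by rewrite -expr2 (le_trans h)// -mulrA ler_wpM2l// posW.
  by rewrite ler_pM2r ?exprn_gt0// in h3; rewrite mulrC.
(* Since |v| <= K |W v|, the previous bound gives |v|^2 <= K^2 N <W v, v>, so [m] can be raised by 1
   / L; the summand 1 keeps [L] positive. *)
pose L := K ^+ 2 * N + 1.
have L0 : 0 < L by rewrite ltr_wpDl// mulr_ge0 ?sqr_ge0.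
have : E (m + L^-1).
  move=> v; have x0 := posW v; have zx := Wsqr v.
  have yz : rnorm v ^+ 2 <= K ^+ 2 * rnorm (poly_op q T v) ^+ 2.
    by rewrite -exprMn lerXn2r ?nnegrE ?mulr_ge0 ?rnorm_ge0// -{1}(WV v).
  have xE : rdot (poly_op q T v) v = rdot (S v) v - m * rnorm v ^+ 2.
    by rewrite qE rdotBl rdotZl -(rnorm_sqr dotE).
  rewrite mulrDl -lerBrDl -xE ler_pdivrMl// /L mulrDl mul1r -mulrA.
  have := ler_wpM2l (sqr_ge0 K) zx; lra.
move=> /(ub_le_sup E_ub); rewrite -/m gerDl invr_le0 leNgt L0//.
Qed.

(** The remaining constant case is reached by adding d X^2, nonnegative on the real line and of
    degree 2, and letting d tend to 0. *)
Lemma spectral_ge0 T r u : sop T ->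
  (forall t : R, spectrum T t%:C -> 0 <= r.[t]) -> 0 <= rdot (poly_op r T u) u.
Proof.
move=> sT hr; have [r1|r1] := ltnP 1 (size r); first exact: spectral_ge0_nonconst.
have [lT [M M0 hM] syT] := sT.
have XX d : 0 < d -> 0 <= rdot (poly_op (r + d *: ('X * 'X)) T u) u.
  move=> d0; apply: spectral_ge0_nonconst => //.
    rewrite addrC size_polyDl ?size_scale ?gt_eqF// -expr2 size_polyXn//.
    exact: leq_ltn_trans r1 _.
  move=> t /hr rt; rewrite hornerD hornerZ hornerM hornerX.
  by have := mulr_ge0 (ltW d0) (sqr_ge0 t); lra.
apply/ler_addgt0Pr => e e0.
pose d := e / (M * rnorm u ^+ 2 * M + 1).
have D0 : 0 < M * rnorm u ^+ 2 * M + 1.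
  by rewrite ltr_wpDl// mulr_ge0// mulr_ge0// sqr_ge0.
have := XX d (divr_gt0 e0 D0).
rewrite poly_opD poly_opZ// poly_opM// !poly_opX rdotDl rdotZl syT -(rnorm_sqr dotE).
move=> /le_trans; apply; rewrite lerD2l.
rewrite /d mulrAC ler_pdivrMr// ler_wpM2l ?ltW//.
have : rnorm (T u) ^+ 2 <= (M * rnorm u) ^+ 2.
  by rewrite lerXn2r ?nnegrE ?mulr_ge0 ?rnorm_ge0.
lra.
Qed.

(** The polynomial e^2 - r^2 is nonnegative on the spectrum, and r(T) is symmetric, so its quadratic
    form is e^2 |u|^2 - |r(T) u|^2. *)
Lemma spectral_norm_le T r (e : R) u : sop T -> 0 <= e ->
  (forall t : R, spectrum T t%:C -> `|r.[t]| <= e) ->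
  rnorm (poly_op r T u) <= e * rnorm u.
Proof.
move=> sT e0 hr; have [lT bT syT] := sT.
rewrite -(@ler_pXn2r _ 2) ?nnegrE ?mulr_ge0 ?rnorm_ge0//.
rewrite exprMn !(rnorm_sqr dotE) -subr_ge0.
have -> : e ^+ 2 * rdot u u - rdot (poly_op r T u) (poly_op r T u) =
    rdot (poly_op ((e ^+ 2)%:P - r * r) T u) u.
  have [_ _ syr] := sop_poly r sT.
  by rewrite poly_opB// poly_opC poly_opM// rdotBl rdotZl !syr.
apply: spectral_ge0 => // t /hr rt; rewrite !hornerE subr_ge0 -expr2.
by rewrite -[leLHS]real_normK ?num_real// lerXn2r ?nnegrE.
Qed.

Lemma spectrum_numerical_bounds T (m M t : R) : sop T ->
  (forall u, m * rnorm u ^+ 2 <= rdot (T u) u <= M * rnorm u ^+ 2) ->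
  spectrum T t%:C -> m <= t <= M.
Proof.
move=> sT hT; have [lT bT syT] := sT.
have sTt (c : R) : sop (fun u => c%:C *: (T u - t%:C *: u)).
  rewrite (_ : (fun u => _) = poly_op (c *: ('X - t%:P)) T); first exact: sop_poly.
  by apply/funext => u; rewrite poly_opZ// poly_opB// poly_opX poly_opC.
move=> tT; apply/andP; split; rewrite leNgt; apply/negP => mt; move: tT;
  apply/notin_spectrum => //.
  have := sTt 1; rewrite (_ : (fun u => _) = fun u => T u - t%:C *: u); last first.
    by apply/funext => u; rewrite scale1r.
  move=> s1; apply: (coercive_invertible dotE s1 (c := m - t)); first by rewrite subr_gt0.
  move=> u; rewrite rdotBl rdotZl -(rnorm_sqr dotE) mulrBl lerB//.
  by have /andP[] := hT u.
(* Above [M] it is -(T - t) that is coercive; the sign is then moved into the argument of the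
   inverse. *)
have [||V [lV bV WV VW]] := @coercive_invertible _ _ _ dotE _ (t - M) (sTt (-1)).
- by rewrite subr_gt0.
- move=> u; rewrite rdotZl rdotBl rdotZl -(rnorm_sqr dotE).
  have /andP[_] := hT u; lra.
exists (fun u => V (- u)); split.
- by move=> a u v; rewrite opprD -scalerN lV.
- by have [K K0 hK] := bV; exists K => // u; rewrite -(rnormN u).
- by move=> u; rewrite -[RHS]WV rmorphN1 scaleN1r.
- by move=> u; have := VW (- u); rewrite rmorphN1 scaleN1r => /oppr_inj.
Qed.

End PolynomialCalculus.

(** * Continuous functional calculus *)

Section ContinuousCalculus.
Context {R : realType} {H : completeNormedModType R[i]}
  (dot : {dot H for (@Num.conj R[i])}).
Hypothesis dotE : forall u, `|u| ^+ 2 = dot u u.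
Implicit Types (u v w : H) (T S P Q A : H -> H) (f g : R -> R) (r p : {poly R}).
Local Notation rdot := (rdot dot).
Local Notation sop := (sop dot).

Definition positive_op T := forall u, 0 <= rdot (T u) u.

Lemma is_cfc_approx f T S (e : R) : is_cfc f T S -> 0 < e ->
  exists p, (forall t : R, spectrum T t%:C -> `|p.[t] - f t| <= e) /\
    forall u, rnorm (poly_op p T u - S u) <= e * rnorm u.
Proof.
move=> fTS /fTS[p [hf hS]]; exists p; split => // u.
by have := hS u; rewrite !normr_rnorm -rmorphM lecR.
Qed.

(** Only e <= 1 has to be treated, so that terms in e^2 can be absorbed into terms in e. *)
Lemma rnorm_le_eps (u : H) (C : R) :
  (forall e : R, 0 < e -> e <= 1 -> rnorm u <= e * C) -> u = 0.
Proof.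
move=> h; apply: rnorm_eq0; apply/le_anti; rewrite rnorm_ge0 andbT.
apply/ler_addgt0Pr => e e0; rewrite add0r.
have C0 : 0 <= C.
  by have := h 1 ltr01 (lexx _); rewrite mul1r; exact/le_trans/rnorm_ge0.
pose d := Num.min 1 (e / (C + 1)).
have d0 : 0 < d by rewrite lt_min ltr01 divr_gt0// ltr_wpDl.
apply: le_trans (h d d0 _) _; first by rewrite ge_min lexx.
have : d * (C + 1) <= e by rewrite -ler_pdivlMr ?ltr_wpDl// ge_min lexx orbT.
lra.
Qed.

Lemma is_cfc_sop f T S : sop T -> is_cfc f T S -> sop S.
Proof.
move=> sT fTS; have [lT bT syT] := sT; split.
- move=> a u v; apply/eqP; rewrite -subr_eq0; apply/eqP.
  apply: (@rnorm_le_eps _ (rnorm (a *: u + v) + complex.Re `|a| * rnorm u + rnorm v)).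
  move=> e e0 _; have [p [_ hp]] := is_cfc_approx fTS e0.
  have [lp _ _] := sop_poly p sT.
  have -> : S (a *: u + v) - (a *: S u + S v) =
     - (poly_op p T (a *: u + v) - S (a *: u + v)) +
     (a *: (poly_op p T u - S u) + (poly_op p T v - S v)).
    by rewrite lp scalerBr [X in _ = _ + X]addrACA -opprD opprB addrA subrK.
  have a0 : 0 <= complex.Re `|a| by rewrite -ler0c RRe_real ?normr_real.
  apply: le_trans (rnormD _ _) _; rewrite rnormN.
  have := rnormD (a *: (poly_op p T u - S u)) (poly_op p T v - S v).
  rewrite rnormZ; have := hp v; have := hp (a *: u + v).
  have := ler_wpM2l a0 (hp u); lra.
- have [p [_ hp]] := is_cfc_approx fTS ltr01.
  have [_ [M M0 hM] _] := sop_poly p sT; exists (M + 1); first by rewrite addr_ge0.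
  move=> u; have -> : S u = poly_op p T u - (poly_op p T u - S u).
    by rewrite opprB addrCA subrr addr0.
  by rewrite (le_trans (rnormB _ _))// mulrDl lerD.
- move=> u v; apply/eqP; rewrite -subr_eq0 -normr_eq0 eq_le normr_ge0 andbT.
  apply/ler_addgt0Pr => e e0; rewrite add0r.
  pose d := e / (2 * (rnorm u * rnorm v + 1)).
  have D0 : 0 < 2 * (rnorm u * rnorm v + 1).
    by rewrite mulr_gt0// ltr_wpDl// mulr_ge0// rnorm_ge0.
  have d0 : 0 < d by rewrite divr_gt0.
  have [p [_ hp]] := is_cfc_approx fTS d0; have [_ _ syp] := sop_poly p sT.
  have h1 := cauchy_schwarz dotE (poly_op p T u - S u) v.
  have h2 := cauchy_schwarz dotE u (poly_op p T v - S v).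
  have h3 := ler_wpM2r (rnorm_ge0 v) (hp u).
  have h4 := ler_wpM2l (rnorm_ge0 u) (hp v).
  have de : d * (2 * (rnorm u * rnorm v + 1)) = e by rewrite divfK// gt_eqF.
  move: h1 h2; rewrite rdotBl rdotBr syp.
  have -> : rdot (S u) v - rdot u (S v) = (rdot u (poly_op p T v) - rdot u (S v)) -
     (rdot u (poly_op p T v) - rdot (S u) v) by ring.
  move=> h1 h2; rewrite (le_trans (ler_normB _ _))//; lra.
Qed.

(** If [p] approximates [f] within [d], then p - r + d is nonnegative on the spectrum. All later
    lower bounds on f(T) come from polynomial minorants through this lemma. *)
Lemma is_cfc_ge f T S r u : sop T -> is_cfc f T S ->
  (forall t : R, spectrum T t%:C -> r.[t] <= f t) ->
  rdot (poly_op r T u) u <= rdot (S u) u.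
Proof.
move=> sT fTS hr; have [lT _ _] := sT; apply/ler_addgt0Pr => e e0.
pose d := e / (2 * (rnorm u ^+ 2 + 1)).
have D0 : 0 < 2 * (rnorm u ^+ 2 + 1) by rewrite mulr_gt0// ltr_wpDl// sqr_ge0.
have d0 : 0 < d by rewrite divr_gt0.
have de : d * (2 * (rnorm u ^+ 2 + 1)) = e by rewrite divfK// gt_eqF.
have [p [hf hp]] := is_cfc_approx fTS d0.
have : 0 <= rdot (poly_op (p - r + d%:P) T u) u.
  apply: (spectral_ge0 dotE) => // t tT; rewrite !hornerE.
  by have := hf t tT; have := hr t tT; rewrite ler_norml; lra.
have := le_trans (ler_norm _) (cauchy_schwarz dotE (poly_op p T u - S u) u).
have := ler_wpM2r (rnorm_ge0 u) (hp u).
rewrite poly_opD poly_opB// poly_opC !rdotDl !rdotNl rdotZl -(rnorm_sqr dotE); lra.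
Qed.

(** Approximants of [f] on the spectrum give operators that are Cauchy in operator norm, by
    [spectral_norm_le]; the pointwise limit satisfies [is_cfc], so [xget] returns a genuine
    value. *)
Lemma cfcP f T : sop T ->
  (forall e : R, 0 < e -> exists p, forall t : R, spectrum T t%:C ->
     `|p.[t] - f t| <= e) ->
  is_cfc f T (cfc f T).
Proof.
move=> sT hf; have [lT _ _] := sT.
suff [S fTS] : exists S, is_cfc f T S.
  by rewrite /cfc; case: xgetP => [S' _ //|/(_ S) /= []].
have n0 (n : nat) : 0 < n.+1%:R^-1 :> R by rewrite invr_gt0.
have /choice[p hp] : forall n : nat, exists p, forall t : R, spectrum T t%:C ->
    `|p.[t] - f t| <= n.+1%:R^-1 by move=> n; exact: hf.
have small (e : R) : 0 < e -> exists N, forall n, (N <= n)%N -> n.+1%:R^-1 <= e.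
  move=> e0; exists (Num.truncn e^-1) => n Nn.
  rewrite -[leRHS]invrK lef_pV2 ?posrE ?invr_gt0//.
  by rewrite (le_trans (ltW (truncnS_gt _)))// ler_nat.
have hpp m n u : rnorm (poly_op (p m) T u - poly_op (p n) T u) <=
    (m.+1%:R^-1 + n.+1%:R^-1) * rnorm u.
  rewrite -poly_opB//; apply: (spectral_norm_le dotE) => //.
  move=> t tT; have h1 := hp m t tT; have h2 := hp n t tT.
  rewrite hornerD hornerN.
  rewrite (_ : _ - _ = ((p m).[t] - f t) - ((p n).[t] - f t)); last by ring.
  by rewrite (le_trans (ler_normB _ _))// lerD.
have /choice[S hS] : forall u, exists l, forall e : R, 0 < e -> exists N,
    forall n, (N <= n)%N -> rnorm (poly_op (p n) T u - l) <= e.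
  move=> u; apply: rnorm_complete => e e0.
  have D0 : 0 < 2 * (rnorm u + 1) by rewrite mulr_gt0// ltr_wpDl// rnorm_ge0.
  have [N hN] := small _ (divr_gt0 e0 D0).
  exists N => m n /hN hm /hN hn; apply: le_trans (hpp m n u) _.
  have := divr_gt0 e0 D0.
  have : e / (2 * (rnorm u + 1)) * (2 * (rnorm u + 1)) = e by rewrite divfK// gt_eqF.
  move: (m.+1%:R^-1) (n.+1%:R^-1) (e / _) hm hn => a b d ad bd.
  have := ler_wpM2r (rnorm_ge0 u) ad; have := ler_wpM2r (rnorm_ge0 u) bd; lra.
exists S => e e0.
have e20 : 0 < e / 2 by rewrite divr_gt0.
have [N hN] := small _ e20.
exists (p N); split.
  move=> t tT; apply: le_trans (hp _ _ tT) _; have := hN N (leqnn _).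
  by move: (N.+1%:R^-1) => a; lra.
move=> u; rewrite !normr_rnorm -rmorphM lecR; apply/ler_addgt0Pr => d d0.
have [K hK] := hS u d d0; pose n := maxn N K.
have h1 := hK n (leq_maxr _ _).
have h2 := hpp N n u; have h3 := hN N (leqnn _); have h4 := hN n (leq_maxl _ _).
have -> : poly_op (p N) T u - S u = (poly_op (p N) T u - poly_op (p n) T u) +
    (poly_op (p n) T u - S u) by rewrite addrA subrK.
apply: le_trans (rnormD _ _) _; apply: lerD => //.
apply: le_trans h2 _; apply: ler_wpM2r; [exact: rnorm_ge0|].
move: (N.+1%:R^-1) (n.+1%:R^-1) h3 h4 => a b; lra.
Qed.

Lemma positive_spectrum T : sop T -> positive_op T ->
  exists2 M : R, 0 < M & forall t : R, spectrum T t%:C -> 0 <= t <= M.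
Proof.
move=> sT pT; have [_ [M M0 hM] _] := sT; exists (M + 1); first by rewrite ltr_wpDl.
move=> t; apply: (spectrum_numerical_bounds dotE sT) => u; rewrite mul0r pT/=.
have := le_trans (ler_norm _) (rdot_bound dotE u hM); have := sqr_ge0 (rnorm u); lra.
Qed.

Lemma cfc_continuousP f T : sop T -> positive_op T ->
  (forall M : R, {within `[0, M], continuous f}) -> is_cfc f T (cfc f T).
Proof.
move=> sT pT cf; have [M M0 hM] := positive_spectrum sT pT.
apply: cfcP => // e e0; have [p hp] := weierstrass M0 (cf M) e0.
by exists p => t /hM; exact: hp.
Qed.

Lemma is_cfc_positive f T S : sop T -> positive_op T -> is_cfc f T S ->
  (forall t : R, 0 <= t -> 0 <= f t) -> positive_op S.
Proof.
move=> sT pT fTS f0 u; have [M _ hM] := positive_spectrum sT pT.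
have := @is_cfc_ge f T S 0%:P u sT fTS; rewrite poly_opC rdotZl mul0r; apply.
by move=> t /hM/andP[t0 _]; rewrite hornerC f0.
Qed.

(** With v = p(T) u, the difference S S u - T u splits into S (S u - v), S v - p(T) v and (p^2 -
    X)(T) u. These contribute N, N + 1 and 2 sqrt M + 1 to the constant. *)
Lemma is_cfc_sqrtK T S : sop T -> positive_op T -> is_cfc Num.sqrt T S ->
  forall u, S (S u) = T u.
Proof.
move=> sT pT fTS u; have [lT _ _] := sT.
have sS := is_cfc_sop sT fTS; have [lS [N N0 hN] _] := sS.
have [M M0 hM] := positive_spectrum sT pT.
apply/eqP; rewrite -subr_eq0; apply/eqP.
apply: (@rnorm_le_eps _ ((2 * N + 1 + (2 * Num.sqrt M + 1)) * rnorm u)) => e e0 e1.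
have [p [hf hp]] := is_cfc_approx fTS e0.
pose v := poly_op p T u.
have hv : rnorm v <= (N + 1) * rnorm u.
  have -> : v = (v - S u) + S u by rewrite subrK.
  apply: le_trans (rnormD _ _) _; have := hp u; have := hN u; rewrite -/v.
  have := ler_wpM2r (rnorm_ge0 u) e1; lra.
have h1 : rnorm (S (S u - v)) <= N * (e * rnorm u).
  by apply: le_trans (hN _) _; rewrite ler_wpM2l// rnorm_distC hp.
have h2 : rnorm (S v - poly_op p T v) <= e * ((N + 1) * rnorm u).
  by rewrite rnorm_distC (le_trans (hp _))// ler_wpM2l// ltW.
have h3 : rnorm (poly_op p T v - T u) <= e * (2 * Num.sqrt M + 1) * rnorm u.
  have -> : poly_op p T v - T u = poly_op (p * p - 'X) T u.
    by rewrite poly_opB// poly_opM// poly_opX.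
  apply: (spectral_norm_le dotE) => //.
    by rewrite mulr_ge0 ?(ltW e0)// addr_ge0// mulr_ge0// sqrtr_ge0.
  move=> t tT; have /andP[t0 tM] := hM t tT; have ps := hf t tT.
  have sM : Num.sqrt t <= Num.sqrt M by rewrite ler_sqrt// ltW.
  have s0 := sqrtr_ge0 t.
  rewrite hornerD hornerN hornerM hornerX -[X in _ - X](sqr_sqrtr t0).
  move: (Num.sqrt t) (Num.sqrt M) s0 sM ps => s m s0 sm ps.
  have -> : p.[t] * p.[t] - s ^+ 2 = (p.[t] - s) * ((p.[t] - s) + 2 * s) by ring.
  rewrite normrM ler_pM// (le_trans (ler_normD _ _))//.
  by rewrite (ger0_norm (mulr_ge0 _ s0))//; lra.
have -> : S (S u) - T u = S (S u - v) + ((S v - poly_op p T v) + (poly_op p T v - T u)).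
  by rewrite (opB lS) !addrA !subrK.
apply: le_trans (rnormD _ _) _.
have := rnormD (S v - poly_op p T v) (poly_op p T v - T u); lra.
Qed.

Lemma poly_op_sqr S T r u : linear S -> linear T -> (forall u, S (S u) = T u) ->
  poly_op (r \Po ('X * 'X)) S u = poly_op r T u.
Proof.
move=> lS lT ST; elim/poly_ind: r u => [|r c IH] u.
  by rewrite comp_poly0 -polyC0 !poly_opC.
rewrite comp_polyD comp_polyM comp_polyX comp_polyC !poly_opD !poly_opM// !poly_opC.
by rewrite IH !poly_opX ST.
Qed.

Lemma poly_op_intertwine A T S r u : linear A -> linear T -> linear S ->
  (forall u, A (T u) = S (A u)) -> A (poly_op r T u) = poly_op r S (A u).
Proof.
move=> lA lT lS AT; elim/poly_ind: r u => [|r c IH] u.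
  by rewrite -polyC0 !poly_opC (opZ lA).
by rewrite !poly_opD !poly_opM// !poly_opC (opD lA) (opZ lA) IH !poly_opX AT.
Qed.

(** * The absolute value of an operator and its powers *)

Section AbsoluteValue.
Variables (A : H -> H) (lA : linear A) (bA : bounded_op A).
Let As := adjoint dot A.
Let lAs : linear As. Proof. exact: adjoint_linear. Qed.
Let bAs : bounded_op As. Proof. exact: adjoint_bounded. Qed.

Lemma rdot_adjoint u v : rdot (A u) v = rdot u (As v).
Proof. by rewrite !rdotE adjointP. Qed.

Lemma normal_sop : sop (As \o A).
Proof.
split; [exact: linear_comp|exact: bounded_op_comp|].
by move=> u v /=; rewrite -rdot_adjoint rdotC -rdot_adjoint rdotC.
Qed.

Lemma normal_positive : positive_op (As \o A).
Proof. by move=> u /=; rewrite rdotC -rdot_adjoint (rdot_ge0 dotE). Qed.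

Lemma abs_op_cfc : is_cfc Num.sqrt (As \o A) (abs_op dot A).
Proof.
apply: cfc_continuousP; [exact: normal_sop|exact: normal_positive|].
by move=> M; apply: continuous_subspaceT; exact: sqrt_continuous.
Qed.

Lemma abs_op_sop : sop (abs_op dot A).
Proof. exact: is_cfc_sop normal_sop abs_op_cfc. Qed.

Lemma abs_op_positive : positive_op (abs_op dot A).
Proof.
apply: is_cfc_positive normal_sop normal_positive abs_op_cfc _.
by move=> t _; exact: sqrtr_ge0.
Qed.

Lemma abs_op_sqr u : abs_op dot A (abs_op dot A u) = As (A u).
Proof. exact: is_cfc_sqrtK normal_sop normal_positive abs_op_cfc u. Qed.

Section Power.
Variables (s : R) (s0 : 0 <= s).

Lemma abs_pow_cfc : is_cfc (fun t => t `^ s) (abs_op dot A) (abs_pow dot A s).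
Proof.
apply: cfc_continuousP; [exact: abs_op_sop|exact: abs_op_positive|].
by move=> M; exact: within_powR_continuous.
Qed.

Lemma abs_pow_sop : sop (abs_pow dot A s).
Proof. exact: is_cfc_sop abs_op_sop abs_pow_cfc. Qed.

Lemma abs_pow_positive : positive_op (abs_pow dot A s).
Proof.
apply: is_cfc_positive abs_op_sop abs_op_positive abs_pow_cfc _.
by move=> t _; exact: powR_ge0.
Qed.

(** Compares polynomials in A^* A with a power of |A| without identifying |A|^s with a power of A^*
    A: substitute X^2 in [r] and use |A|^2 = A^* A. [M] comes before [r] and [d], since the
    approximating polynomials are chosen only once the interval is known. *)
Lemma abs_pow_ge : exists2 M : R, 0 < M & forall r (d : R) u,
  (forall t : R, 0 <= t <= M -> r.[t] <= t `^ (s / 2) + d) ->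
  rdot (poly_op r (As \o A) u) u <= rdot (abs_pow dot A s u) u + d * rnorm u ^+ 2.
Proof.
have [M M0 hM] := positive_spectrum abs_op_sop abs_op_positive.
exists (M ^+ 2); first exact: exprn_gt0.
move=> r d u hr; have [lS _ _] := abs_op_sop; have [lT _ _] := normal_sop.
rewrite -(@poly_op_sqr (abs_op dot A))//; last exact: abs_op_sqr.
have := @is_cfc_ge _ _ _ (r \Po ('X * 'X) - d%:P) u abs_op_sop abs_pow_cfc.
rewrite poly_opB// poly_opC rdotBl rdotZl -(rnorm_sqr dotE) -lerBlDr; apply.
move=> t /hM /andP[t0 tM]; rewrite hornerD hornerN hornerC horner_comp hornerM hornerX.
rewrite lerBlDr; have := hr (t * t).
have -> : (t * t) `^ (s / 2) = t `^ s.
  by rewrite -expr2 -powR_mulrn// -powRrM; congr (_ `^ _); field.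
by apply; rewrite -expr2 sqr_ge0/= lerXn2r// nnegrE ltW.
Qed.

End Power.
End AbsoluteValue.
End ContinuousCalculus.

(** * Mixed Schwarz inequality *)

Section PowerSplitting.
Context {R : realType}.

(** [a] and [b] approximate [u] and [v], the powers al / 2 and - al / 2 of t + e, whose product is
    1. The shift costs at most e^al in the first bound, by subadditivity, and only helps in the
    second. *)
Lemma powR_split_approx (al m d : R) : 0 <= al <= 1 -> 0 < m -> 0 < d ->
  exists a b : {poly R}, forall t, 0 <= t <= m ->
    [/\ (a * a).[t] <= t `^ al + d, ('X * (b * b)).[t] <= t `^ (1 - al) + d
      & `|(b * a).[t] - 1| <= d].
Proof.
move=> /andP[al0 al1] m0 d0; move: al0; rewrite le_eqVlt => /predU1P[<-|al0].
  exists 1, 1 => t /andP[t0 tm]; rewrite subr0 powRr0 powRr1//.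
  rewrite !hornerM !hornerC hornerX !mulr1 subrr normr0; split; lra.
(* Half of [d] pays for the shift and half for the polynomial error. Such an [e] needs al > 0,
   whence the separate case al = 0 with a = b = 1. *)
have [e e0 eE] : exists2 e : R, 0 < e & e `^ al = d / 2.
  exists ((d / 2) `^ al^-1); first by rewrite powR_gt0// divr_gt0.
  by rewrite -powRrM mulVf ?gt_eqF// powRr1// divr_ge0// ltW.
pose u t := (t + e) `^ (al / 2); pose v t := (t + e) `^ (- (al / 2)).
have al2 : 0 <= al / 2 by rewrite divr_ge0// ltW.
pose C := (m + e) `^ (al / 2) + e `^ (- (al / 2)).
have u_ge0 t : 0 <= u t by exact: powR_ge0.
have v_ge0 t : 0 <= v t by exact: powR_ge0.
have uv t : 0 <= t -> u t * v t = 1.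
  by move=> t0; rewrite /u /v powRN mulfV// gt_eqF// powR_gt0// ltr_wpDl.
have uC t : 0 <= t <= m -> u t <= C.
  move=> /andP[t0 tm]; apply: (@le_trans _ _ ((m + e) `^ (al / 2))).
    by rewrite ge0_ler_powR// ?nnegrE ?addr_ge0 ?(ltW e0) ?(ltW m0)// lerD2r.
  by rewrite /C lerDl powR_ge0.
have vC t : 0 <= t <= m -> v t <= C.
  move=> /andP[t0 tm]; apply: (@le_trans _ _ (e `^ (- (al / 2)))).
    have te0 : 0 < t + e by rewrite ltr_wpDl.
    rewrite /v !powRN lef_pV2 ?posrE ?powR_gt0//.
    by rewrite ge0_ler_powR// ?nnegrE ?addr_ge0 ?(ltW e0)// lerDr.
  by rewrite /C lerDr powR_ge0.
have C0 : 0 <= C by rewrite addr_ge0// powR_ge0.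
have u2 t : 0 <= t -> u t ^+ 2 <= t `^ al + d / 2.
  move=> t0; rewrite /u -powR_mulrn ?powR_ge0// -powRrM divfK// -eE.
  by apply: powRD_subadditive => //; rewrite ltW.
have v2 t : 0 <= t -> t * v t ^+ 2 <= t `^ (1 - al).
  rewrite le_eqVlt => /predU1P[<-|t0]; first by rewrite mul0r powR_ge0.
  rewrite powRB; last by rewrite (gt_eqF t0) implybT.
  rewrite powRr1 ?(ltW t0)// ler_wpM2l ?(ltW t0)//.
  have te0 : 0 < t + e by rewrite addr_gt0.
  rewrite /v -powR_mulrn ?powR_ge0// -powRrM mulNr divfK// powRN.
  rewrite lef_pV2 ?posrE ?powR_gt0//.
  by rewrite ge0_ler_powR// ?nnegrE ?(ltW al0) ?addr_ge0 ?(ltW e0) ?(ltW t0)// lerDl ltW.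
have D0 : 0 < 2 * ((2 * C + 1) * (m + 1)) by rewrite !mulr_gt0//; lra.
(* An approximation error h <= 1 changes a square by at most h (2 C + 1); multiplied by [m + 1],
   which also covers the factor ['X], this stays below d / 2. *)
pose h := Num.min 1 (d / (2 * ((2 * C + 1) * (m + 1)))).
have h0 : 0 < h by rewrite lt_min ltr01 divr_gt0.
have h1 : h <= 1 by rewrite ge_min lexx.
have hD : h * (2 * ((2 * C + 1) * (m + 1))) <= d.
  by rewrite -ler_pdivlMr// ge_min lexx orbT.
have cu (r : R) := within_shifted_powR_continuous (r := r) (M := m) e0.
have [a ha] := weierstrass m0 (cu (al / 2)) h0.
have [b hb] := weierstrass m0 (cu (- (al / 2))) h0.
exists a, b => t tm; have /andP[t0 tm'] := tm.
have {}ha := ha t tm; have {}hb := hb t tm; rewrite -/(u t) in ha; rewrite -/(v t) in hb.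
have {}uC := uC t tm; have {}vC := vC t tm.
have {}uv := uv t t0; have {}u2 := u2 t t0; have {}v2 := v2 t t0.
have {}u_ge0 := u_ge0 t; have {}v_ge0 := v_ge0 t.
rewrite !hornerM hornerX.
move: (a.[t]) (b.[t]) (u t) (v t) ha hb uC vC uv u2 v2 u_ge0 v_ge0.
move=> x y p q; rewrite !ler_norml => /andP[x1 x2] /andP[y1 y2] pC qC pq p2 q2 p0 q0.
have K0 : 0 <= h * (2 * C + 1) by rewrite mulr_ge0 ?(ltW h0)//; lra.
have sq z w : 0 <= w -> w <= C -> - h <= z - w -> z - w <= h ->
    z * z <= w ^+ 2 + h * (2 * C + 1).
  move=> w0 wC z1 z2; rewrite -subr_ge0.
  have -> : w ^+ 2 + h * (2 * C + 1) - z * z =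
     (h - (z - w)) * (2 * w) + (h - (z - w)) * (h + (z - w))
     + 2 * (h * (C - w)) + h * (1 - h) by ring.
  rewrite !addr_ge0// ?mulr_ge0//; lra.
split.
- have := sq x p p0 pC x1 x2; have : 0 <= h * (2 * C + 1) * m by rewrite mulr_ge0// ltW.
  lra.
- have h2 := ler_wpM2l t0 (sq y q q0 qC y1 y2).
  have : h * (2 * C + 1) * t <= h * (2 * C + 1) * m by rewrite ler_wpM2l.
  lra.
- have xC : `|x| <= C + h by rewrite ler_norml; lra.
  have -> : y * x - 1 = (y - q) * x + q * (x - p) by rewrite -pq; ring.
  have n1 : `|(y - q) * x| <= h * (C + h).
    by rewrite normrM ler_pM// ler_norml y1.
  have n2 : `|q * (x - p)| <= C * h.
    by rewrite normrM ler_pM// ?(ger0_norm q0)// ler_norml x1.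
  have : `|(y - q) * x + q * (x - p)| <= d.
    rewrite (le_trans (ler_normD _ _))//.
    have : h * h <= h * 1 by rewrite ler_wpM2l// ltW.
    have : 0 <= h * (2 * C + 1) * m by rewrite mulr_ge0// ltW.
    lra.
  by rewrite ler_norml.
Qed.

End PowerSplitting.

Section MixedSchwarz.
Context {R : realType}.
Context {H : completeNormedModType R[i]} (dot : {dot H for (@Num.conj R[i])}).
Hypothesis dotE : forall u, `|u| ^+ 2 = dot u u.
Local Notation rdot := (rdot dot).
Implicit Types (u v x y : H).

Section Operator.
Variables (A : H -> H) (lA : linear A) (bA : bounded_op A).
Variables (al : R) (al01 : 0 <= al <= 1).
Let As := adjoint dot A.
Let P := abs_pow dot A (2 * al).
Let Q := abs_pow dot As (2 * (1 - al)).

(* The square of the norm of [a(A^* A) x - b(A^* A) A^* y] is nonnegative, where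
   [a t] and [b t] approximate [t `^ (al / 2)] and [t `^ (- al / 2)]. *)
Let mixed_am_gm x y : 2 * rdot (A x) y <= rdot (P x) x + rdot (Q y) y.
Proof.
have lAs : linear As by exact: adjoint_linear.
have bAs : bounded_op As by exact: adjoint_bounded.
have AK : adjoint dot As = A by exact: adjointK.
have sT := normal_sop dotE lA bA; rewrite -/As in sT; set T := As \o A in sT.
have pT : positive_op dot T by exact: normal_positive.
have sT' := normal_sop dotE lAs bAs; rewrite AK in sT'; set T' := A \o As in sT'.
have [lT _ _] := sT; have [lT' _ _] := sT'.
have /andP[al0 al1] := al01.
have [|M1 M10 h1] := @abs_pow_ge _ _ dot dotE A lA bA (2 * al); first by rewrite mulr_ge0.
have [|M2 M20 h2] := @abs_pow_ge _ _ dot dotE As lAs bAs (2 * (1 - al)).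
  by rewrite mulr_ge0// subr_ge0.
have [M3 M30 h3] := positive_spectrum dotE sT pT.
rewrite -/As -/T -/P in h1; rewrite AK -/T' -/Q in h2.
have [N N0 hN] := bAs.
pose D := rnorm x ^+ 2 + rnorm y ^+ 2 + 2 * N * (rnorm x * rnorm y) + 1.
have D0 : 0 < D.
  by rewrite ltr_wpDl// !addr_ge0// ?sqr_ge0// !mulr_ge0// rnorm_ge0.
apply/ler_addgt0Pr => e e0.
pose d := e / D; have d0 : 0 < d by rewrite divr_gt0.
have dD : d * D = e by rewrite divfK// gt_eqF.
(* One interval for the three estimates: the two power bounds and the spectrum of A^* A. *)
have m0 : 0 < M1 + M2 + M3 by rewrite !addr_gt0.
have [a [b ab]] := powR_split_approx al01 m0 d0.
have {}h1 : rdot (poly_op (a * a) T x) x <= rdot (P x) x + d * rnorm x ^+ 2.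
  apply: h1 => t /andP[t0 tM]; have [|+ _ _] := ab t; first lra.
  by rewrite (_ : 2 * al / 2 = al)//; field.
have {}h2 : rdot (poly_op ('X * (b * b)) T' y) y <= rdot (Q y) y + d * rnorm y ^+ 2.
  apply: h2 => t /andP[t0 tM]; have [|_ + _] := ab t; first lra.
  by rewrite (_ : 2 * (1 - al) / 2 = 1 - al)//; field.
have {}h3 : rnorm (poly_op (b * a - 1%:P) T x) <= d * rnorm x.
  apply: (spectral_norm_le dotE) => //; first exact: ltW.
  move=> t /h3/andP[t0 tM]; have [|_ _] := ab t; first lra.
  by rewrite hornerD hornerN hornerC.
have [_ _ sya] := sop_poly a sT; have [_ _ syb] := sop_poly b sT.
set z := poly_op a T x; set w := poly_op b T (As y).
have e1 : rdot z z = rdot (poly_op (a * a) T x) x.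
  by rewrite poly_opM// -/z sya.
have e2 : rdot z w = rdot (poly_op (b * a - 1%:P) T x) (As y) + rdot (A x) y.
  (* Up to the error of b a - 1, the cross term is <x, A^* y> = <A x, y>. *)
  rewrite poly_opB// poly_opC scale1r rdotBl -[rdot x _]rdot_adjoint// subrK.
  by rewrite poly_opM// -/z syb.
have e3 : rdot w w = rdot (poly_op ('X * (b * b)) T' y) y.
  (* Intertwining: T' b(T')^2 y = A b(T)^2 A^* y, so the form at y is the squared norm of b(T) A^*
     y. *)
  rewrite mulrC poly_opM// poly_opX /T' /= -(@poly_op_intertwine _ _ A T)//.
  by rewrite rdot_adjoint// -/As poly_opM// -/w syb.
have h4 := cauchy_schwarz dotE (poly_op (b * a - 1%:P) T x) (As y).
have h5 := ler_pM (rnorm_ge0 _) (rnorm_ge0 _) h3 (hN y).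
have := rdot_ge0 dotE (z - w); rewrite rdotBl !rdotBr (rdotC _ w z) e1 e2 e3.
move: (le_trans h4 h5); rewrite ler_norml => /andP[h6 _].
rewrite -dD /D; lra.
Qed.

Lemma mixed_schwarz x y : rdot (A x) y ^+ 2 <= rdot (P x) x * rdot (Q y) y.
Proof.
have lAs : linear As by exact: adjoint_linear.
have bAs : bounded_op As by exact: adjoint_bounded.
have /andP[al0 al1] := al01.
have s1 : 0 <= 2 * al by rewrite mulr_ge0.
have s2 : 0 <= 2 * (1 - al) by rewrite mulr_ge0// subr_ge0.
have [lP _ _] : sop dot P := abs_pow_sop dotE lA bA s1.
have [lQ _ _] : sop dot Q := abs_pow_sop dotE lAs bAs s2.
apply: discriminant_le0; [exact: abs_pow_positive|exact: abs_pow_positive|].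
move=> s t; have := mixed_am_gm (s%:C *: x) (t%:C *: y).
by rewrite (opZ lA) (opZ lP) (opZ lQ) !rdotZl !rdotZr; lra.
Qed.

End Operator.
End MixedSchwarz.

(** * Berezin number *)

Section OrliczBound.
Context {R : realType} {H : completeNormedModType R[i]}
  (dot : {dot H for (@Num.conj R[i])}).
Hypothesis dotE : forall u, `|u| ^+ 2 = dot u u.
Local Notation rdot := (rdot dot).
Local Notation sop := (sop dot).
Implicit Types (f g : R -> R) (P Q A : H -> H) (k : H).

Lemma Re_normc_sqr (z : R[i]) :
  complex.Re `|z| ^+ 2 = complex.Re z ^+ 2 + complex.Im z ^+ 2.
Proof. by rewrite normc_def /= sqr_sqrtr// addr_ge0// sqr_ge0. Qed.

Lemma Re_normc_ge0 (z : R[i]) : 0 <= complex.Re `|z|.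
Proof. by rewrite normc_def sqrtr_ge0. Qed.

Lemma Re_normcD (z w : R[i]) :
  complex.Re `|z + w| <= complex.Re `|z| + complex.Re `|w|.
Proof. by have := ler_normD z w; rewrite lecE raddfD => /andP[]. Qed.

(** The constant 2 is crude, from separate bounds on real and imaginary parts; it serves only to
    show that the set defining [ber] is bounded. *)
Lemma dot_bound u v : complex.Re `|dot u v| <= 2 * (rnorm u * rnorm v).
Proof.
have iv : rnorm ('i *: v) = rnorm v.
  by rewrite rnormZ normc_def/= expr0n/= add0r expr1n sqrtr1 mul1r.
have := cauchy_schwarz dotE u v; have := cauchy_schwarz dotE u ('i *: v).
rewrite iv; have := mulr_ge0 (rnorm_ge0 u) (rnorm_ge0 v).
move: (rnorm u * rnorm v) => x x0 h1 h2.
rewrite -(@ler_pXn2r _ 2) ?nnegrE ?mulr_ge0 ?Re_normc_ge0//.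
rewrite Re_normc_sqr dot_rdot /=.
have sq y : `|y| <= x -> y ^+ 2 <= x ^+ 2.
  by move=> yx; rewrite -real_normK ?num_real// lerXn2r ?nnegrE.
have := sq _ h1; have := sq _ h2; have := sqr_ge0 x; lra.
Qed.

Lemma sop_dot_real S u : sop S -> dot (S u) u = (rdot (S u) u)%:C.
Proof.
move=> [lS _ syS]; rewrite dot_rdot; congr (_ +i* _).
have := rdot_iC dot (S u) u.
rewrite -(opZ lS) (syS ('i *: u)) (rdotC dot ('i *: u)); lra.
Qed.

Lemma cartesian_bound F G u : sop F -> sop G ->
  rdot (F u) u + rdot (G u) u <= Num.sqrt 2 * complex.Re `|dot (F u + 'i *: G u) u|.
Proof.
move=> sF sG.
have -> : dot (F u + 'i *: G u) u = (rdot (F u) u)%:C + 'i * (rdot (G u) u)%:C.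
  by rewrite linearDl/= linearZl_LR/= (sop_dot_real u sF) (sop_dot_real u sG).
move: (rdot _ _) (rdot _ _) => y x.
apply: le_trans (ler_norm _) _.
rewrite -(@ler_pXn2r _ 2) ?nnegrE ?mulr_ge0 ?sqrtr_ge0 ?Re_normc_ge0//.
rewrite real_normK ?num_real// exprMn sqr_sqrtr// Re_normc_sqr /=.
by have := sqr_ge0 (x - y); lra.
Qed.

(** From real part to modulus: take y = z v with z = <A u, v>. Both sides then carry a factor |z|^2,
    which cancels unless z = 0. *)
Lemma dot_mixed_schwarz A (al : R) u v : linear A -> bounded_op A -> 0 <= al <= 1 ->
  complex.Re `|dot (A u) v| ^+ 2 <=
  rdot (abs_pow dot A (2 * al) u) u *
  rdot (abs_pow dot (adjoint dot A) (2 * (1 - al)) v) v.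
Proof.
move=> lA bA al01; have /andP[al0 al1] := al01.
have lAs : linear (adjoint dot A) by exact: adjoint_linear.
have bAs : bounded_op (adjoint dot A) by exact: adjoint_bounded.
have s2 : 0 <= 2 * (1 - al) by rewrite mulr_ge0// subr_ge0.
have s1 : 0 <= 2 * al by rewrite mulr_ge0.
have sQ := abs_pow_sop dotE lAs bAs s2; have [lQ _ _] := sQ.
set z := dot (A u) v; set m := complex.Re `|z| ^+ 2.
have := mixed_schwarz dotE lA bA al01 u (z *: v).
have -> : rdot (A u) (z *: v) = m.
  rewrite !rdotE linearZr_LR/= -/z /m Re_normc_sqr.
  by case: (z) => x y /=; ring.
have -> : rdot (abs_pow dot (adjoint dot A) (2 * (1 - al)) (z *: v)) (z *: v) =
    m * rdot (abs_pow dot (adjoint dot A) (2 * (1 - al)) v) v.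
  rewrite (opZ lQ) !rdotE linearZr_LR/= linearZl_LR/= (sop_dot_real v sQ) /m Re_normc_sqr.
  by case: (z) => x y /=; ring.
have p1 := abs_pow_positive dotE lA bA s1 u.
have p2 := abs_pow_positive dotE lAs bAs s2 v.
have m0 : 0 <= m by exact: sqr_ge0.
rewrite mulrCA expr2; move: m0; rewrite le_eqVlt => /predU1P[<- _|m0].
  by rewrite mulr_ge0.
by rewrite ler_pM2l.
Qed.

(* Young's inequality on the spectra takes the place of Jensen's: it gives
   [t * <Pk, k> - <f(P)k, k> <= g t] for all [t >= 0], and then the same step is
   made with [Q] in place of [t]. *)
Lemma young_cfc f g P Q k : sop P -> positive_op dot P -> sop Q -> positive_op dot Q ->
  is_cfc f P (cfc f P) -> is_cfc g Q (cfc g Q) ->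
  (forall s t : R, 0 <= s -> 0 <= t -> s * t <= f s + g t) -> rnorm k = 1 ->
  rdot (P k) k * rdot (Q k) k <= rdot (cfc f P k) k + rdot (cfc g Q k) k.
Proof.
move=> sP pP sQ pQ fP gQ yfg k1; have [lP _ _] := sP; have [lQ _ _] := sQ.
have kk : rdot k k = 1 by rewrite -(rnorm_sqr dotE) k1 expr1n.
have [M _ hM] := positive_spectrum dotE sP pP.
have [N _ hN] := positive_spectrum dotE sQ pQ.
have h1 t : 0 <= t -> t * rdot (P k) k - g t <= rdot (cfc f P k) k.
  move=> t0; have := @is_cfc_ge _ _ dot dotE _ _ _ (t *: 'X - (g t)%:P) k sP fP.
  rewrite poly_opB// poly_opZ// poly_opX poly_opC rdotBl !rdotZl kk mulr1; apply.
  move=> s /hM/andP[s0 _]; rewrite hornerD hornerN hornerZ hornerX hornerC.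
  by have := yfg s t s0 t0; lra.
have := @is_cfc_ge _ _ dot dotE _ _ _
  (rdot (P k) k *: 'X - (rdot (cfc f P k) k)%:P) k sQ gQ.
rewrite poly_opB// poly_opZ// poly_opX poly_opC rdotBl !rdotZl kk mulr1 lerBlDl.
apply=> t /hN/andP[t0 _]; rewrite hornerD hornerN hornerZ hornerX hornerC.
by have := h1 t t0; lra.
Qed.

Section Complementary.
Variables (f g : R -> R) (fg : complementary f g).

Lemma complementary_young s t : 0 <= s -> 0 <= t -> s * t <= f s + g t.
Proof. by have [_ [p [pK fE gE]]] := fg; exact: young fE gE _ _. Qed.

Lemma complementary_continuousl M : {within `[0, M], continuous f}.
Proof.
have [[cf _ _ _ _] _] := fg; apply: continuous_subspaceW cf => t /=.
by rewrite !in_itv/= andbT => /andP[].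
Qed.

Lemma complementary_continuousr M : {within `[0, M], continuous g}.
Proof. by have [_ [p [pK _ gE]]] := fg; exact: complementary_continuous gE _. Qed.

Variables (A : H -> H) (lA : linear A) (bA : bounded_op A).
Variables (al : R) (al01 : 0 <= al <= 1).
Let P := abs_pow dot A (2 * al).
Let Q := abs_pow dot (adjoint dot A) (2 * (1 - al)).

Let sP : sop P /\ positive_op dot P.
Proof.
have /andP[al0 _] := al01; have s0 : 0 <= 2 * al by rewrite mulr_ge0.
by split; [exact: abs_pow_sop|exact: abs_pow_positive].
Qed.

Let sQ : sop Q /\ positive_op dot Q.
Proof.
have /andP[_ al1] := al01.
have s0 : 0 <= 2 * (1 - al) by rewrite mulr_ge0// subr_ge0.
have lAs : linear (adjoint dot A) by exact: adjoint_linear.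
have bAs : bounded_op (adjoint dot A) by exact: adjoint_bounded.
by split; [exact: abs_pow_sop|exact: abs_pow_positive].
Qed.

Let fP : is_cfc f P (cfc f P).
Proof. by apply: (cfc_continuousP dotE sP.1 sP.2); exact: complementary_continuousl. Qed.

Let gQ : is_cfc g Q (cfc g Q).
Proof. by apply: (cfc_continuousP dotE sQ.1 sQ.2); exact: complementary_continuousr. Qed.

Lemma cfc_abs_pow_sop : sop (cfc f P) /\ sop (cfc g Q).
Proof. by split; [exact: is_cfc_sop sP.1 fP|exact: is_cfc_sop sQ.1 gQ]. Qed.

Lemma orlicz_bound k : rnorm k = 1 ->
  complex.Re `|dot (A k) k| ^+ 2 <= rdot (cfc f P k) k + rdot (cfc g Q k) k.
Proof.
move=> k1; apply: le_trans (dot_mixed_schwarz k k lA bA al01) _.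
exact: (young_cfc sP.1 sP.2 sQ.1 sQ.2 fP gQ complementary_young k1).
Qed.

End Complementary.
End OrliczBound.

Section BerezinNumber.
Context {R : realType} {X : Type} (H : rkhs R X).
Hypothesis rkernel_neq0 : forall x : X, rkernel H x != 0.
Let dotE := rkhs_normE (r := H).
Implicit Types T : H -> H.

Lemma rnorm_nrkernel x : rnorm (nrkernel H x) = 1.
Proof.
apply: complexI; rewrite -normr_rnorm /nrkernel normrZ normfV normr_id mulVf//.
by rewrite normr_eq0; exact: rkernel_neq0.
Qed.

Lemma le_ber T x : bounded_op T ->
  complex.Re `|rkhs_dot H (T (nrkernel H x)) (nrkernel H x)| <= ber H T.
Proof.
move=> [M M0 hM]; apply: ub_le_sup; last by exists x.
exists (2 * M) => _ [y _ <-]; apply: le_trans (dot_bound dotE _ _) _.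
by have := hM (nrkernel H y); rewrite rnorm_nrkernel !mulr1 ler_pM2l.
Qed.

Lemma ber_le T (C : R) : inhabited X ->
  (forall x, complex.Re `|rkhs_dot H (T (nrkernel H x)) (nrkernel H x)| <= C) ->
  ber H T <= C.
Proof.
move=> [x0] hC; apply: ge_sup; last by move=> _ [x _ <-].
by exists (complex.Re `|rkhs_dot H (T (nrkernel H x0)) (nrkernel H x0)|), x0.
Qed.

Lemma ber_ge0 T : inhabited X -> bounded_op T -> 0 <= ber H T.
Proof. by move=> [x] /(le_ber x); apply: le_trans; exact: Re_normc_ge0. Qed.

End BerezinNumber.

Theorem theorem3p10 (R : realType) (X : Type) (X_nonempty : inhabited X)
    (H : rkhs R X) (rkernel_neq0 : forall x : X, rkernel H x != 0)
    (A B : {linear H -> H}) (A_cont : continuous A) (B_cont : continuous B)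
    (f1 g1 f2 g2 : R -> R)
    (fg1 : complementary f1 g1) (fg2 : complementary f2 g2)
    (alpha beta lambda : R)
    (alpha01 : 0 <= alpha <= 1) (beta01 : 0 <= beta <= 1)
    (lambda01 : 0 <= lambda <= 1) :
  let absp (T : H -> H) r := abs_pow (rkhs_dot H) T r in
  let adj (T : H -> H) := adjoint (rkhs_dot H) T in
  ber H (fun u => A u + B u) ^+ 2 <=
  2 * wmean lambda
        (ber H A ^+ 2 + ber H B ^+ 2)
        (Num.sqrt 2 *
         ber H (fun u =>
                cfc f1 (absp A (2 * alpha)) u + cfc f2 (absp B (2 * beta)) u +
                'i *: (cfc g1 (absp (adj A) (2 * (1 - alpha))) u +
                       cfc g2 (absp (adj B) (2 * (1 - beta))) u))).
Proof.
cbv zeta beta.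
have dotE := rkhs_normE (r := H).
have lA : linear A := linearP A; have lB : linear B := linearP B.
have bA : bounded_op A by exact: continuous_bounded_op.
have bB : bounded_op B by exact: continuous_bounded_op.
have [sF1 sG1] := cfc_abs_pow_sop dotE fg1 lA bA alpha01.
have [sF2 sG2] := cfc_abs_pow_sop dotE fg2 lB bB beta01.
have hA := orlicz_bound dotE fg1 lA bA alpha01.
have hB := orlicz_bound dotE fg2 lB bB beta01.
set F1 := cfc f1 _ in sF1 hA *; set F2 := cfc f2 _ in sF2 hB *.
set G1 := cfc g1 _ in sG1 hA *; set G2 := cfc g2 _ in sG2 hB *.
clearbody F1 F2 G1 G2.
set W := fun u : H => F1 u + F2 u + _.
have sF := sopD sF1 sF2; have sG := sopD sG1 sG2.
have bW : bounded_op W.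
  apply: bounded_opD; first by case: sF.
  by apply: (bounded_op_comp (bounded_opZ (H := H) 'i)); case: sG.
set bAB := _ + _ ^+ 2.
(* Both bounds are kept at each point [x], since the weighted mean is formed before the supremum is
   taken. *)
have bound x : let k := nrkernel H x in
    complex.Re `|rkhs_dot H (A k) k| ^+ 2 + complex.Re `|rkhs_dot H (B k) k| ^+ 2
    <= Num.min bAB (Num.sqrt 2 * ber H W).
  move=> k; have k1 : rnorm k = 1 by exact: rnorm_nrkernel.
  rewrite le_min; apply/andP; split.
    by rewrite lerD// lerXn2r ?nnegrE ?Re_normc_ge0 ?ber_ge0// le_ber.
  apply: le_trans (lerD (hA _ k1) (hB _ k1)) _.
  apply: le_trans (ler_wpM2l (sqrtr_ge0 2) (le_ber rkernel_neq0 x bW)).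
  apply: le_trans (cartesian_bound k sF sG).
  by rewrite !rdotDl addrACA.
have bAB0 : 0 <= bAB by rewrite addr_ge0// sqr_ge0.
have sW0 : 0 <= Num.sqrt 2 * ber H W by rewrite mulr_ge0 ?sqrtr_ge0 ?ber_ge0.
have /andP[l0 l1] := lambda01.
have wmean0 : 0 <= wmean lambda bAB (Num.sqrt 2 * ber H W).
  by rewrite addr_ge0// mulr_ge0// subr_ge0.
have bS : bounded_op (fun u : H => A u + B u) by exact: bounded_opD.
(* [ber] is a supremum of moduli, not of squares: the right-hand side is written as the square of
   its root, which then bounds each modulus. *)
rewrite -[leRHS]sqr_sqrtr ?mulr_ge0// lerXn2r ?nnegrE ?sqrtr_ge0 ?ber_ge0//.
apply: ber_le => // x; set k := nrkernel H x.
rewrite -(@ler_pXn2r _ 2) ?nnegrE ?sqrtr_ge0 ?Re_normc_ge0// sqr_sqrtr ?mulr_ge0//.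
have := bound x; rewrite /= -/k le_min => /andP[h1 h2].
rewrite linearDl/=; set a := rkhs_dot H (A k) k in h1 h2 *.
set b := rkhs_dot H (B k) k in h1 h2 *.
apply: (@le_trans _ _ (2 * (complex.Re `|a| ^+ 2 + complex.Re `|b| ^+ 2))).
  apply: (@le_trans _ _ ((complex.Re `|a| + complex.Re `|b|) ^+ 2)).
    by rewrite lerXn2r ?nnegrE ?addr_ge0 ?Re_normc_ge0// Re_normcD.
  by have := sqr_ge0 (complex.Re `|a| - complex.Re `|b|); lra.
rewrite ler_pM2l// /wmean.
set y := _ + _ in h1 h2 *.
(* [y] is its own weighted mean, so its two upper bounds apply to the two summands. *)
have -> : y = (1 - lambda) * y + lambda * y by ring.
by rewrite lerD// ler_wpM2l// subr_ge0.
Qed.
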